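(* Let $n\geq 3$ and let $M\in\{\mathcal{AOP}_n,\mathcal{AOR}_n\}$. Then the set $\mathrm{Con}(M)$ of all congruences of $M$ consists of the universal congruence $\omega$ and all congruences of the following form: (1) if either $M=\mathcal{AOP}_n$ and $n$ is odd, or $M=\mathcal{AOR}_n$ and $n\not\equiv 2\ (\mathrm{mod}\ 4)$: $\pi_{J_k^M}^{\varrho}$, with $\varrho$ a congruence of the group $H^M_{\mathrm{id}_{\{1,\ldots,k\}}}$, for some $1\leq k\leq n$; (2) if either $M=\mathcal{AOP}_n$ and $n$ is even, or $M=\mathcal{AOR}_n$ and $n\equiv 2\ (\mathrm{mod}\ 4)$: $\pi_{J_k^M}^{\varrho}$, with $\varrho$ a congruence of the group $H^M_{\mathrm{id}_{\{1,\ldots,k\}}}$, for some $1\leq k\leq n-2$ or $k=n$; and $\pi_{J_{n-1}^{o,M}}^{\varrho_1}$, $\pi_{J_{n-1}^{e,M}}^{\varrho_2}$ and $\theta_{J_{n-1}^{o,M}}^{\varrho_1}\cup\theta_{J_{n-1}^{e,M}}^{\varrho_2}$, with $\varrho_1$ and $\varrho_2$ congruences of the groups $H^M_{\mathrm{id}_{\{2,\ldots,n\}}}$ and $H^M_{\mathrm{id}_{\{1,\ldots,n-1\}}}$, respectively.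
   Context: Monoids. Let $\Omega_n=\{1<2<\cdots<n\}$ and let $\mathcal{I}_n$ be the symmetric inverse monoid on $\Omega_n$ (all injective partial maps, i.e. partial permutations, of $\Omega_n$), with maps written on the right and composed left to right: $x(\alpha\beta)=(x\alpha)\beta$. The alternating inverse monoid is $\mathcal{AI}_n=\{\alpha\in\mathcal{I}_n : \alpha=\sigma|_{\mathrm{Dom}(\alpha)}\text{ for some even permutation }\sigma\text{ of }\Omega_n\}$. A partial permutation $\alpha$ with $\mathrm{Dom}(\alpha)=\{a_1<\cdots<a_t\}$, $t\geq 0$, is orientation-preserving [orientation-reversing] if there is at most one $i\in\{1,\ldots,t\}$ with $a_i\alpha>a_{i+1}\alpha$ [$a_i\alpha<a_{i+1}\alpha$], where $a_{t+1}=a_1$; it is oriented if it is orientation-preserving or orientation-reversing. $\mathcal{AOP}_n$ [$\mathcal{AOR}_n$] is the submonoid of all orientation-preserving [oriented] elements of $\mathcal{AI}_n$. Notation. $\mathrm{id}_X$ is the partial identity with domain $X$. For $a,b\in M$: $a\mathscr{J}b$ iff $MaM=MbM$; $J_a$ is the $\mathscr{J}$-class of $a$; $J_a\leq_{\mathscr{J}}J_b$ iff $MaM\subseteq MbM$, and $J_a<_{\mathscr J}J_b$ iff moreover $J_a\neq J_b$; $\mathscr{H}$ is Green's relation (here $\alpha\mathscr{H}\beta$ iff $\mathrm{Dom}(\alpha)=\mathrm{Dom}(\beta)$ and $\mathrm{Im}(\alpha)=\mathrm{Im}(\beta)$), and $H^M_\varepsilon$ is the $\mathscr{H}$-class of $\varepsilon$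 in $M$ (a group if $\varepsilon$ is idempotent). For $|\mathrm{Im}(\alpha)|=n-1$, $\mathrm{d}(\alpha)$ and $\mathrm{i}(\alpha)$ denote the unique elements of $\Omega_n\setminus\mathrm{Dom}(\alpha)$ and $\Omega_n\setminus\mathrm{Im}(\alpha)$. For $A,B\subseteq\Omega_n$ with $|A|=|B|$, let $[A\to B]$ denote the unique order-preserving bijection $A\to B$, as an element of $\mathcal{I}_n$. $\mathscr{J}$-classes. For $0\leq k\leq n-2$ and $k=n$, $J_k^M=\{\alpha\in M:|\mathrm{Im}(\alpha)|=k\}$. If $M=\mathcal{AOP}_n$ with $n$ odd, or $M=\mathcal{AOR}_n$ with $n\not\equiv 2\ (\mathrm{mod}\ 4)$, then $J_{n-1}^M=\{\alpha\in M:|\mathrm{Im}(\alpha)|=n-1\}$. If $M=\mathcal{AOP}_n$ with $n$ even, or $M=\mathcal{AOR}_n$ with $n\equiv 2\ (\mathrm{mod}\ 4)$, then $J_{n-1}^{o,M}$ [$J_{n-1}^{e,M}$] is the set of $\alpha\in M$ with $|\mathrm{Im}(\alpha)|=n-1$ and $\mathrm{d}(\alpha)$ odd [even]. For $k\geq 1$ all these sets are $\mathscr{J}$-classes of $M$. The relations $\theta$ and $\pi$. For a $\mathscr{J}$-class $J$ of $M$ let $A(J)=\{a\in M: J_a<_{\mathscr{J}}J\}$ and $B(J)=\{a\in M: J\not\leq_{\mathscr{J}}J_a\}$. Given a map $J\to H^M_\varepsilon$, $\alpha\mapsto\widetilde{\alpha}$ (specified below for each $J$, with $\varepsilon\in J$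 idempotent), and a congruence $\varrho$ of the group $H^M_\varepsilon$, the relation $\theta_J^\varrho$ [respectively, $\pi_J^\varrho$] on $M$ is defined by: $x$ is related to $y$ iff (i) $x=y$; or (ii) $x,y\in A(J)$ [respectively, $x,y\in B(J)$]; or (iii) $x,y\in J$, $x\mathscr{H}y$ and $\widetilde{x}\,\varrho\,\widetilde{y}$. The maps $\alpha\mapsto\widetilde\alpha$. If $J=J_n^M$ is the group of units, $\varepsilon=\mathrm{id}_{\Omega_n}$ and $\widetilde{\alpha}=\alpha$. Otherwise $\widetilde{\alpha}=\widetilde{\alpha}_L\,\alpha\,\widetilde{\alpha}_R$, where: (a) $J=J_k^M$, $1\leq k\leq n-2$: $\varepsilon=\mathrm{id}_{\{1,\ldots,k\}}$, $\widetilde{\alpha}_L=[\{1,\ldots,k\}\to\mathrm{Dom}(\alpha)]$, $\widetilde{\alpha}_R=[\mathrm{Im}(\alpha)\to\{1,\ldots,k\}]$. For rank $n-1$ put $\alpha_L=[\{1,\ldots,n-1\}\to\mathrm{Dom}(\alpha)]$, $\alpha_R=[\mathrm{Im}(\alpha)\to\{1,\ldots,n-1\}]$, and let $g_n,h_n\in\mathcal{I}_n$ have domain and image $\{1,\ldots,n-1\}$, with $xg_n=x+1$ for $1\leq x\leq n-2$, $(n-1)g_n=1$, and $xh_n=n-x$. (b) $J=J_{n-1}^{e,M}$: $\varepsilon=\mathrm{id}_{\{1,\ldots,n-1\}}$, $\widetilde{\alpha}_L=\alpha_L$, $\widetilde{\alpha}_R=\alpha_R$. (c) $J=J_{n-1}^{o,M}$: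 $\varepsilon=\mathrm{id}_{\{2,\ldots,n\}}$, $\widetilde{\alpha}_L=[\{2,\ldots,n\}\to\mathrm{Dom}(\alpha)]$, $\widetilde{\alpha}_R=[\mathrm{Im}(\alpha)\to\{2,\ldots,n\}]$. (d) $J=J_{n-1}^M$ with $n$ odd: $\varepsilon=\mathrm{id}_{\{1,\ldots,n-1\}}$; $\widetilde{\alpha}_L=\alpha_L$ if $\mathrm{d}(\alpha)$ is odd and $g_n^{-1}\alpha_L$ if $\mathrm{d}(\alpha)$ is even; $\widetilde{\alpha}_R=\alpha_R$ if $\mathrm{i}(\alpha)$ is odd and $\alpha_Rg_n$ if $\mathrm{i}(\alpha)$ is even. (e) $J=J_{n-1}^M$ with $M=\mathcal{AOR}_n$ and $n\equiv 0\ (\mathrm{mod}\ 4)$: $\varepsilon=\mathrm{id}_{\{1,\ldots,n-1\}}$; $\widetilde{\alpha}_L=\alpha_L$ if $\mathrm{d}(\alpha)$ is even and $h_n\alpha_L$ if $\mathrm{d}(\alpha)$ is odd; $\widetilde{\alpha}_R=\alpha_R$ if $\mathrm{i}(\alpha)$ is even and $\alpha_Rh_n$ if $\mathrm{i}(\alpha)$ is odd. *)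

(* Defs.v *)
From HB Require Import structures.
From mathcomp Require Import all_boot all_fingroup.

Set Implicit Arguments.
Unset Strict Implicit.
Unset Printing Implicit Defensive.

Import GroupScope.

(* Submonoids are given as sets in an ambient finite *-monoid, so that         *)
(* fingroup's setwise products M * [set a] * M, a *: M and M :* a are the     *)
(* principal ideals of a in M. A relation on S is a subset of S x S.          *)

Section Green.

Variables (T : finStarMonoidType) (M : {set T}).

Definition congruence (S : {set T}) (R : {set T * T}) : Prop :=
  [/\ R \subset setX S S,
      [/\ forall x, x \in S -> (x, x) \in R,
          forall x y, (x, y) \in R -> (y, x) \in R &
          forall x y z, (x, y) \in R -> (y, z) \in R -> (x, z) \in R]
    & forall x y z, (x, y) \in R -> z \in S ->
        (z * x, z * y) \in R /\ (x * z, y * z) \in R].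

Definition ideal (a : T) : {set T} := M * [set a] * M.

Definition Jclass (a : T) : {set T} := [set b in M | ideal b == ideal a].

(* The order is independent of the chosen representatives. *)
Definition leJ (J1 J2 : {set T}) : bool :=
  [exists a in J1, exists b in J2, ideal a \subset ideal b].

Definition ltJ (J1 J2 : {set T}) : bool := leJ J1 J2 && (J1 != J2).

Definition greenH (a b : T) : bool := (a *: M == b *: M) && (M :* a == M :* b).

Definition Hclass (e : T) : {set T} := [set a in M | greenH a e].

Definition belowJ (J : {set T}) : {set T} := [set a in M | ltJ (Jclass a) J].

Definition notaboveJ (J : {set T}) : {set T} :=
  [set a in M | ~~ leJ J (Jclass a)].

Definition collapse (I J : {set T}) (tl : T -> T) (rho : {set T * T}) :
    {set T * T} :=
  [set p in setX M M |
    [|| p.1 == p.2,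
        (p.1 \in I) && (p.2 \in I)
      | [&& p.1 \in J, p.2 \in J, greenH p.1 p.2
          & (tl p.1, tl p.2) \in rho]]].

Definition thetaJ (J : {set T}) (tl : T -> T) (rho : {set T * T}) :=
  collapse (belowJ J) J tl rho.

Definition piJ (J : {set T}) (tl : T -> T) (rho : {set T * T}) :=
  collapse (notaboveJ J) J tl rho.

End Green.

Definition pinjective n (f : {ffun 'I_n -> option 'I_n}) : bool :=
  [forall x, forall y, (f x != None) && (f x == f y) ==> (x == y)].

Record pperm n :=
  PPerm {pfun :> {ffun 'I_n -> option 'I_n}; _ : pinjective pfun}.

HB.instance Definition _ n := [isSub for @pfun n].
HB.instance Definition _ n := [Finite of pperm n by <:].

Section SymmetricInverseMonoid.

Variable n : nat.
Implicit Types (a b c : pperm n) (f : {ffun 'I_n -> option 'I_n}).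

Lemma pinjectiveP f :
  reflect (forall x y z, f x = Some z -> f y = Some z -> x = y) (pinjective f).
Proof.
apply: (iffP forallP) => [inj x y z fx fy | inj x].
  by have /forallP/(_ y)/implyP := inj x; rewrite fx fy !eqxx => /(_ isT)/eqP.
apply/forallP=> y; apply/implyP; case fx: (f x) => [z|] //= /eqP/esym fy.
by apply/eqP/(inj x y z).
Qed.

Lemma pperm_inj a x y z : a x = Some z -> a y = Some z -> x = y.
Proof. by case: a => f fi /=; apply/pinjectiveP. Qed.

Lemma ppermP a b : (forall x, a x = b x) -> a = b.
Proof. by move=> eq_ab; apply/val_inj/ffunP. Qed.

Lemma ppermPS a b : (forall x y, a x = Some y <-> b x = Some y) -> a = b.
Proof.
move=> eq_ab; apply: ppermP => x.
case ax: (a x) => [y|]; first by rewrite (eq_ab x y).1.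
by case bx: (b x) => [y|] //; move/eq_ab: bx; rewrite ax.
Qed.

Definition mulf a b := [ffun x => obind b (a x)].

Lemma mulfP a b x z :
  (mulf a b x = Some z) <-> (exists2 y, a x = Some y & b y = Some z).
Proof.
rewrite ffunE; case: (a x) => [y|] /=; last by split=> // - [].
by split=> [|[_ [<-]]] //; exists y.
Qed.

Lemma mulf_pinj a b : pinjective (mulf a b).
Proof.
apply/pinjectiveP=> x y z /mulfP[t ax bt] /mulfP[u ay bu].
by move: ay; rewrite -(pperm_inj bt bu); apply: pperm_inj.
Qed.

Definition pmul a b := PPerm (mulf_pinj a b).

Definition idf (A : {set 'I_n}) := [ffun x => if x \in A then Some x else None].

Lemma idf_pinj A : pinjective (idf A).
Proof.
apply/pinjectiveP=> x y z; rewrite !ffunE.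
by do 2![case: ifP => // _] => - [->] [->].
Qed.

Definition pid A : pperm n := PPerm (idf_pinj A).

Definition invf a := [ffun y => [pick x | a x == Some y]].

Lemma invfP a x y : (invf a y = Some x) <-> (a x = Some y).
Proof.
rewrite ffunE; case: pickP => [z /eqP az | no]; split=> //.
- by case=> <-.
- by move=> ax; rewrite (pperm_inj az ax).
- by move=> ax; move: (no x); rewrite ax eqxx.
Qed.

Lemma invf_pinj a : pinjective (invf a).
Proof. by apply/pinjectiveP=> x y z /invfP + /invfP => -> []. Qed.

Definition pinv a : pperm n := PPerm (invf_pinj a).

Fact pmulA : associative pmul.
Proof.
by move=> a b c; apply: ppermP => x; rewrite /= !ffunE; case: (a x) => //= y;
  rewrite ffunE.
Qed.

Fact pmul1 : left_id (pid setT) pmul.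
Proof. by move=> a; apply: ppermP => x; rewrite /= !ffunE inE. Qed.

Fact pinvK : involutive pinv.
Proof. by move=> a; apply: ppermPS => x y; split=> [/invfP/invfP | ax] //; do 2!apply/invfP. Qed.

Fact pinvM : {morph pinv : a b / pmul a b >-> pmul b a}.
Proof.
move=> a b; apply: ppermPS => x y; split.
  by move=> /invfP/mulfP[z ay bz]; apply/mulfP; exists z; apply/invfP.
by move=> /mulfP[z /invfP ay /invfP bz]; apply/invfP/mulfP; exists z.
Qed.

HB.instance Definition _ :=
  isStarMonoid.Build (pperm n) pmulA pmul1 pinvK pinvM.

Definition Dom a : {set 'I_n} := [set x | a x != None].

Definition Im a : {set 'I_n} := [set y | [exists x, a x == Some y]].

(* The element x of {1, ..., n} is represented by the i : 'I_n with           *)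
(* label i = x; parities below are those of labels.                           *)
Definition label (i : 'I_n) : nat := i.+1.

Definition point (x : nat) : option 'I_n := [pick i | label i == x].

Definition seg (x y : nat) : {set 'I_n} := [set i | x <= label i <= y].

Definition alternating a : bool :=
  [exists s : 'S_n, ~~ odd_perm s && [forall x in Dom a, a x == Some (s x)]].

(* [:: a_1 alpha; ...; a_t alpha] for Dom(alpha) = {a_1 < ... < a_t} *)
Definition images a : seq 'I_n := pmap a (enum 'I_n).

Definition orientation_preserving a : bool :=
  count (fun p : 'I_n * 'I_n => p.1 > p.2) (zip (images a) (rot 1 (images a)))
    <= 1.

Definition orientation_reversing a : bool :=
  count (fun p : 'I_n * 'I_n => p.1 < p.2) (zip (images a) (rot 1 (images a)))
    <= 1.

Definition oriented a : bool :=
  orientation_preserving a || orientation_reversing a.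

(* [A -> B]; when #|A| <> #|B| it is only a partial map. *)
Definition order_bij_fun (A B : {set 'I_n}) :=
  [ffun x => if x \in A then onth (enum B) (index x (enum A)) else None].

Lemma order_bij_pinj A B : pinjective (order_bij_fun A B).
Proof.
apply/pinjectiveP=> x y z; rewrite !ffunE.
case: ifP => // Ax; case: ifP => // Ay ox oy.
have lt_size t u : onth (enum B) t = Some u -> t < size (enum B).
  by move=> Eu; rewrite -onthTE Eu.
have ixy: index x (enum A) = index y (enum A).
  apply/eqP; rewrite -(nth_uniq z (lt_size _ _ ox) (lt_size _ _ oy) (enum_uniq _)).
  by rewrite (onth_nth z _ _ _ ox) (onth_nth z _ _ _ oy).
rewrite -mem_enum in Ax; rewrite -mem_enum in Ay.
by rewrite -(nth_index x Ax) ixy nth_index.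
Qed.

Definition order_bij A B : pperm n := PPerm (order_bij_pinj A B).

(* The label of the missing point; meaningful only for #|A| = n - 1. *)
Definition missing (A : {set 'I_n}) : nat :=
  if [pick i in ~: A] is Some i then label i else 0.

Definition missing_dom a : nat := missing (Dom a).
Definition missing_im a : nat := missing (Im a).

Lemma pointP x y : point x = Some y <-> label y = x.
Proof.
rewrite /point; case: pickP => [z /eqP <- | no]; split=> //.
- by case=> <-.
- by case=> /ord_inj ->.
- by move=> xy; move: (no y); rewrite xy eqxx.
Qed.

Definition gf :=
  [ffun x => if label x <= n - 2 then point (label x + 1)
             else if label x == n - 1 then point 1 else None].

Lemma gf_pinj : pinjective gf.
Proof.
apply/pinjectiveP=> x y z; rewrite !ffunE => gx gy.
apply/ord_inj/succn_inj; rewrite -/(label x) -/(label y).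
move: gx gy; rewrite !addn1.
case: ifP => _; last case: ifP => // /eqP lx;
  (case: ifP => _; last case: ifP => // /eqP ly); move=> /pointP zx /pointP zy.
- by apply: succn_inj; rewrite -zx.
- by rewrite zx in zy.
- by rewrite zy in zx.
- by rewrite lx.
Qed.

Definition gmap : pperm n := PPerm gf_pinj.

Definition hf :=
  [ffun x => if label x <= n - 1 then point (n - label x) else None].

Lemma hf_pinj : pinjective hf.
Proof.
apply/pinjectiveP=> x y z; rewrite !ffunE.
case: ifP => // _; case: ifP => // _ /pointP hx /pointP hy.
apply/ord_inj/succn_inj; rewrite -(subKn (ltn_ord x)) -(subKn (ltn_ord y)).
by congr (n - _); rewrite -hx.
Qed.

Definition hmap : pperm n := PPerm hf_pinj.

Definition tilde_rank (k : nat) a : pperm n :=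
  order_bij (seg 1 k) (Dom a) * a * order_bij (Im a) (seg 1 k).

Definition alphaL a : pperm n := order_bij (seg 1 (n - 1)) (Dom a).
Definition alphaR a : pperm n := order_bij (Im a) (seg 1 (n - 1)).

Definition tilde_even a : pperm n := alphaL a * a * alphaR a.

Definition tilde_odd a : pperm n :=
  order_bij (seg 2 n) (Dom a) * a * order_bij (Im a) (seg 2 n).

(* For the full class of rank n - 1 with n odd. *)
Definition tilde_n_odd a : pperm n :=
  (if odd (missing_dom a) then alphaL a else gmap^-1 * alphaL a) * a
    * (if odd (missing_im a) then alphaR a else alphaR a * gmap).

(* For the full class of rank n - 1 of AOR_n with n = 0 mod 4. *)
Definition tilde_n_mod4 a : pperm n :=
  (if ~~ odd (missing_dom a) then alphaL a else hmap * alphaL a) * a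
    * (if ~~ odd (missing_im a) then alphaR a else alphaR a * hmap).

Definition tilde (k : nat) a : pperm n :=
  if k == n then a
  else if k <= n - 2 then tilde_rank k a
  else if odd n then tilde_n_odd a else tilde_n_mod4 a.

Definition rankJ (M : {set pperm n}) (k : nat) : {set pperm n} :=
  [set a in M | #|Im a| == k].

Definition oddJ (M : {set pperm n}) : {set pperm n} :=
  [set a in rankJ M (n - 1) | odd (missing_dom a)].

Definition evenJ (M : {set pperm n}) : {set pperm n} :=
  [set a in rankJ M (n - 1) | ~~ odd (missing_dom a)].

End SymmetricInverseMonoid.

Definition AOP n : {set pperm n} :=
  [set a | alternating a && orientation_preserving a].

Definition AOR n : {set pperm n} := [set a | alternating a && oriented a].

Arguments pid {n} A.
Arguments seg {n} x y.
Arguments gmap {n}.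
Arguments hmap {n}.

(* Main.v *)
(* Let R be a congruence of M and Z the R-class of the empty map. If a R b and  *)
(* a, b are not H-related, then both lie in Z: comparing domains (or images)   *)
(* gives id_A R id_(A minus x) for some x in A, and moving points around inside *)
(* M drives id_A down to the empty map. If a R b are H-related and x a <> x b,  *)
(* then id_(Dom a minus x) is in Z. So the ideal Z determines the only J-class  *)
(* (or the two J-classes of rank n - 1) outside Z where R is not the identity,  *)
(* and there R is governed by its restriction to one maximal subgroup.         *)
(*                                                                            *)
(* The shape of the J-order in rank n - 1 is a matter of signs: the order      *)
(* bijection between the complements of i and j has a completion of sign i + j, *)
(* the rotation g_n has sign n, and the reversal h_n has sign (n - 1)/2         *)
(* (rounded down). Orientation is handled through the ternary cyclic order,    *)
(* which makes closure under products and inverses immediate. In the two-class *)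
(* case a unit fixing all points of one parity is trivial, so a nontrivial pair *)
(* of units pushes both classes of rank n - 1 into Z.                           *)
Require Import Defs.
From mathcomp Require Import all_boot all_fingroup.
From mathcomp Require Import zify.

Set Implicit Arguments.
Unset Strict Implicit.
Unset Printing Implicit Defensive.

Import GroupScope.

(** * Partial permutations *)

(** Two mechanisms meet. A frame gives Brandt coordinates on one J-class: a product with a monoid
    element either keeps the rank, and then acts on the group coordinate by a translation, or falls
    into the collapsed ideal. This makes the listed relations congruences ([collapse_congruence],
    [thetaJU_congruence]). Conversely, for a congruence R with zero class Z, every pair of R lies in
    Z or is H-related ([congruence_zero_or_H]), and two H-related maps that disagree at a point
    force a partial identity of rank one less into Z ([zeroclass_moved]). So nontrivial pairs
    outside Z sit just above Z, and [congruence_collapse] rebuilds R from Z and its trace on maximal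
    subgroups. [congruences_one_class] and [congruences_two_classes] carry this out for any inverse
    submonoid that has the right frames.

    It remains to decide which sets of equal size are joined by an element of M. Up to rank n - 2
    every order bijection is alternating ([signed_small]). In rank n - 1 its sign depends on the two
    missing points ([signed_order_bij_C1]); a wrong sign can be repaired by the rotation when n is
    odd, and by the reversal in [AOR n] when n = 0 mod 4 ([frame_twisted]). In the remaining cases
    the parity of the missing point is an invariant ([corank1_parity]), which splits the rank into
    two classes, and [AOR_rigid] controls the units. *)

Section PartialPermutations.

Variable n : nat.
Implicit Types (a b c : pperm n) (x y z : 'I_n) (A B : {set 'I_n}).

Lemma pmulP a b x z :
  ((a * b) x = Some z) <-> (exists2 y, a x = Some y & b y = Some z).
Proof. exact: mulfP. Qed.

Lemma pinvP a x y : (a^-1 y = Some x) <-> (a x = Some y).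
Proof. exact: invfP. Qed.

Lemma pidP A x y : (pid A x = Some y) <-> (x \in A /\ y = x).
Proof.
by rewrite ffunE; case: ifP => Ax; split=> [|[]] // => [[]|_ ->].
Qed.

Lemma DomP a x : reflect (exists y, a x = Some y) (x \in Dom a).
Proof.
rewrite inE; case: (a x) => [y|]; constructor; first by exists y.
by case.
Qed.

Lemma ImP a y : reflect (exists x, a x = Some y) (y \in Im a).
Proof. by rewrite inE; apply: (iffP existsP) => -[x /eqP]; exists x => //; apply/eqP. Qed.

Lemma mem_Dom a x y : a x = Some y -> x \in Dom a.
Proof. by move=> ax; apply/DomP; exists y. Qed.

Lemma mem_Im a x y : a x = Some y -> y \in Im a.
Proof. by move=> ax; apply/ImP; exists x. Qed.

Lemma Dom_pinv a : Dom a^-1 = Im a.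
Proof.
by apply/setP => y; apply/DomP/ImP => -[x]; exists x; apply/pinvP.
Qed.

Lemma Im_pinv a : Im a^-1 = Dom a.
Proof. by rewrite -Dom_pinv invgK. Qed.

Lemma Dom_pid A : Dom (pid A) = A.
Proof.
apply/setP => x; apply/DomP/idP => [[y /pidP[]]//|Ax].
by exists x; apply/pidP.
Qed.

Lemma pid_inv A : (pid A)^-1 = pid A.
Proof.
by apply: ppermPS => x y; split=> [/pinvP/pidP|/pidP] [? ->]; [|apply/pinvP];
  apply/pidP.
Qed.

Lemma Im_pid A : Im (pid A) = A.
Proof. by rewrite -Dom_pinv pid_inv Dom_pid. Qed.

Lemma pidM A B : pid A * pid B = pid (A :&: B).
Proof.
apply: ppermPS => x y; split.
  by move=> /pmulP[z /pidP[Ax ->] /pidP[Bx ->]]; apply/pidP; rewrite inE Ax.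
move=> /pidP[/setIP[Ax Bx] ->]; apply/pmulP.
by exists x; apply/pidP.
Qed.

Lemma pid_mul A a x y : ((pid A * a) x = Some y) <-> (x \in A /\ a x = Some y).
Proof.
split=> [/pmulP[z /pidP[Ax ->]] //|[Ax axy]].
by apply/pmulP; exists x => //; apply/pidP.
Qed.

Lemma mul_pid A a x y : ((a * pid A) x = Some y) <-> (y \in A /\ a x = Some y).
Proof.
split=> [/pmulP[z axz /pidP[Ax ->]] //|[Ay axy]].
by apply/pmulP; exists y => //; apply/pidP.
Qed.

Lemma pid_mul_id A a : Dom a \subset A -> pid A * a = a.
Proof.
move=> /subsetP sA; apply: ppermPS => x y; rewrite pid_mul; split=> [[]//|axy].
by split=> //; apply/sA/(mem_Dom axy).
Qed.

Lemma mul_pid_id A a : Im a \subset A -> a * pid A = a.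
Proof.
move=> /subsetP sA; apply: ppermPS => x y; rewrite mul_pid; split=> [[]//|axy].
by split=> //; apply/sA/(mem_Im axy).
Qed.

Lemma pmulV a : a * a^-1 = pid (Dom a).
Proof.
apply: ppermPS => x y; split.
  move=> /pmulP[z axz /pinvP ayz]; apply/pidP; split; first exact: mem_Dom axz.
  exact: pperm_inj ayz axz.
move=> /pidP[/DomP[z axz] ->]; apply/pmulP; exists z => //; exact/pinvP.
Qed.

Lemma pmulVl a : a^-1 * a = pid (Im a).
Proof. by rewrite -{2}[a]invgK pmulV Dom_pinv. Qed.

Lemma Dom_mul_sub a b : Dom (a * b) \subset Dom a.
Proof.
by apply/subsetP => x /DomP[y /pmulP[z axz _]]; apply: mem_Dom axz.
Qed.

Lemma Im_mul_sub a b : Im (a * b) \subset Im b.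
Proof. by apply/subsetP => x /ImP[y /pmulP[z _ bz]]; apply: mem_Im bz. Qed.

Lemma Dom_mul a b : Im a \subset Dom b -> Dom (a * b) = Dom a.
Proof.
move=> /subsetP sab; apply/eqP; rewrite eqEsubset Dom_mul_sub /=.
apply/subsetP => x /DomP[y axy].
have /DomP[z bz] := sab _ (mem_Im axy).
by apply/DomP; exists z; apply/pmulP; exists y.
Qed.

Lemma Im_mul a b : Dom b \subset Im a -> Im (a * b) = Im b.
Proof. by move=> s; rewrite -Dom_pinv invMg Dom_mul ?Dom_pinv ?Im_pinv. Qed.

Lemma card_Dom a : #|Dom a| = #|Im a|.
Proof.
have le b : #|Im b| <= #|Dom b|.
  have sub : Im b \subset [set odflt x (b x) | x in Dom b].
    apply/subsetP => y /ImP[x bx]; apply/imsetP; exists x; last by rewrite bx.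
    exact: mem_Dom bx.
  exact: leq_trans (subset_leq_card sub) (leq_imset_card _ _).
by apply/eqP; rewrite eqn_leq le andbT -Dom_pinv -(Im_pinv a).
Qed.

Lemma Im_pid_mul1 a x y : a x = Some y -> Im (pid (Dom a :\ x) * a) = Im a :\ y.
Proof.
move=> axy; apply/setP => z; apply/ImP/setD1P.
  move=> [w /pid_mul[/setD1P[nwx _] awz]]; split; last exact: mem_Im awz.
  apply: contraNneq nwx => zy; rewrite zy in awz.
  exact/eqP/(pperm_inj awz axy).
move=> [nzy /ImP[w awz]]; exists w; apply/pid_mul; split=> //.
rewrite !inE awz andbT; apply: contraNneq nzy => wx.
by move: awz; rewrite wx axy => -[->].
Qed.

Lemma Dom_pid_mul A a : Dom (pid A * a) = A :&: Dom a.
Proof.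
apply/setP => x; apply/DomP/setIP; first by move=> [y /pid_mul[Ax /mem_Dom]].
by move=> [Ax /DomP[y axy]]; exists y; apply/pid_mul.
Qed.

Lemma eq_Im_mul a b c : Im a = Im b -> Im (a * c) = Im (b * c).
Proof.
move=> eab; apply/setP => y.
by apply/ImP/ImP => -[x /pmulP[w /mem_Im]]; rewrite (eab, esym eab) => /ImP[x' ?] ?;
  exists x'; apply/pmulP; exists w.
Qed.

Lemma eq_Dom_mul a b c : Dom a = Dom b -> Dom (c * a) = Dom (c * b).
Proof. by rewrite -!Im_pinv !invMg; apply: eq_Im_mul. Qed.

Lemma Im_mul_eq a b : Im (a * b) = Im b -> Dom b \subset Im a.
Proof.
move=> e; apply/subsetP => y /DomP[z byz].
have /ImP[x /pmulP[w aw bwz]] : z \in Im (a * b) by rewrite e (mem_Im byz).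
by rewrite (pperm_inj byz bwz) (mem_Im aw).
Qed.

Lemma Im_mul_card a b : ~~ (Dom b \subset Im a) -> #|Im (a * b)| < #|Im b|.
Proof.
move=> nab; rewrite proper_card // properEneq Im_mul_sub andbT.
by apply: contra nab => /eqP /Im_mul_eq.
Qed.

Lemma Dom_mul_card a b : ~~ (Im a \subset Dom b) -> #|Dom (a * b)| < #|Dom a|.
Proof. by rewrite -!Im_pinv invMg -Dom_pinv; apply: Im_mul_card. Qed.

End PartialPermutations.

(** * Congruences of inverse submonoids *)

Definition inverse_submonoid n (M : {set pperm n}) : Prop :=
  [/\ forall a b, a \in M -> b \in M -> a * b \in M,
      forall a, a \in M -> a^-1 \in M
    & forall A, pid A \in M].

Section InverseSubmonoid.

Variables (n : nat) (M : {set pperm n}).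
Hypothesis invM : inverse_submonoid M.
Implicit Types (a b c u v z : pperm n) (x y : 'I_n) (A B E : {set 'I_n})
  (rho R : {set pperm n * pperm n}).

Let MM a b : a \in M -> b \in M -> a * b \in M.
Proof. by case: invM => h _ _; apply: h. Qed.
Let MV a : a \in M -> a^-1 \in M.
Proof. by case: invM => _ h _; apply: h. Qed.
Let Mid A : pid A \in M. Proof. by case: invM. Qed.

Lemma idealP a b :
  reflect (exists u v, [/\ u \in M, v \in M & a = u * b * v]) (a \in ideal M b).
Proof.
apply: (iffP mulsgP) => [[c v /mulsgP[u _ Mu /set1P-> ->] Mv ->]|].
  by exists u, v.
move=> [u [v [Mu Mv ->]]]; exists (u * b) v => //.
by apply/mulsgP; exists u b; rewrite ?inE.
Qed.

Lemma ideal_id a : a \in ideal M a.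
Proof.
by apply/idealP; exists (pid setT), (pid setT); rewrite !Mid mulg1 mul1g.
Qed.

Lemma ideal_sub a b : (ideal M a \subset ideal M b) = (a \in ideal M b).
Proof.
apply/subsetP/idP => [|/idealP[u [v [Mu Mv ->]]] c]; first by apply; exact: ideal_id.
move=> /idealP[s [t [Ms Mt ->]]]; apply/idealP; exists (s * u), (v * t).
by rewrite !MM // !mulgA.
Qed.

Lemma ideal_trans a b c : a \in ideal M b -> b \in ideal M c -> a \in ideal M c.
Proof. by rewrite -!ideal_sub; apply: subset_trans. Qed.

Lemma ideal_card a b : a \in ideal M b -> #|Im a| <= #|Im b|.
Proof.
move=> /idealP[u [v [_ _ ->]]].
rewrite -card_Dom (leq_trans (subset_leq_card (Dom_mul_sub _ _))) //.
by rewrite card_Dom subset_leq_card // Im_mul_sub.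
Qed.

Lemma leJP (J1 J2 : {set pperm n}) :
  reflect (exists a b, [/\ a \in J1, b \in J2 & a \in ideal M b])
          (leJ M J1 J2).
Proof.
apply: (iffP exists_inP) => [[a Ja /exists_inP[b Jb]]|[a [b [Ja Jb ab]]]].
  by rewrite ideal_sub => ab; exists a, b.
by exists a => //; apply/exists_inP; exists b => //; rewrite ideal_sub.
Qed.

Lemma JclassP a b :
  reflect [/\ b \in M, b \in ideal M a & a \in ideal M b] (b \in Jclass M a).
Proof. by rewrite !inE eqEsubset !ideal_sub; apply: and3P. Qed.

(** If Dom c lies in Dom d then c = d (d^-1 c), so a principal right ideal is determined by the
    domain of its generator; dually, a left one by the image. *)
Lemma greenHE a b : a \in M -> b \in M ->
  greenH M a b = (Dom a == Dom b) && (Im a == Im b).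
Proof.
move=> Ma Mb.
have M1 : 1 \in M by exact: Mid.
have lE c d : c \in M -> d \in M -> (c *: M \subset d *: M) = (Dom c \subset Dom d).
  move=> Mc Md; apply/subsetP/idP => [/(_ c)|sub e].
    move=> h; have /h/mulsgP[_ u /set1P-> _ ->] : c \in c *: M.
      by apply/mulsgP; exists c 1; rewrite ?inE ?mulg1.
    exact: Dom_mul_sub.
  move=> /mulsgP[_ u /set1P-> Mu ->]; apply/mulsgP; exists d (d^-1 * c * u).
  - by rewrite inE.
  - by rewrite !(MM, MV).
  - by rewrite !mulgA pmulV pid_mul_id.
have rE c d : c \in M -> d \in M -> (M :* c \subset M :* d) = (Im c \subset Im d).
  move=> Mc Md; apply/subsetP/idP => [/(_ c)|sub e].
    move=> h; have /h/mulsgP[u _ _ /set1P-> ->] : c \in M :* c.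
      by apply/mulsgP; exists 1 c; rewrite ?inE ?mul1g.
    exact: Im_mul_sub.
  move=> /mulsgP[u _ Mu /set1P-> ->]; apply/mulsgP; exists (u * (c * d^-1)) d.
  - by rewrite !(MM, MV).
  - by rewrite inE.
  - by rewrite -!mulgA pmulVl mul_pid_id.
by rewrite /greenH !eqEsubset !lE // !rE.
Qed.

Lemma HclassE E a :
  (a \in Hclass M (pid E)) = [&& a \in M, Dom a == E & Im a == E].
Proof.
rewrite inE; case Ma: (a \in M) => //=.
by rewrite greenHE // Dom_pid Im_pid.
Qed.

(* [lam X : E -> X] trivialises the J-class of the elements of [M] with domain *)
(* in [D] as a Brandt semigroup over the H-class of [pid E]: the map [tl] is   *)
(* the paper's alpha |-> tilde alpha, and its right factor is always the      *)
(* inverse of a left one.                                                      *)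
Definition frame_by (D : pred {set 'I_n}) E (tl : pperm n -> pperm n)
    (lam : {set 'I_n} -> pperm n) : Prop :=
  [/\ D E,
      forall A, D A -> [/\ lam A \in M, Dom (lam A) = E & Im (lam A) = A],
      forall a, a \in M -> D (Dom a) = D (Im a)
    & forall a, a \in M -> D (Dom a) ->
        tl a = lam (Dom a) * a * (lam (Im a))^-1].

Definition frame D E tl := exists lam, frame_by D E tl lam.

Definition classof (D : pred {set 'I_n}) := [set a in M | D (Dom a)].

(** * Congruences built from a frame *)

Section Frame.

Variables (D : pred {set 'I_n}) (E : {set 'I_n}) (tl : pperm n -> pperm n).
Variable lam : {set 'I_n} -> pperm n.
Hypothesis fr : frame_by D E tl lam.

Let lamM A : D A -> lam A \in M. Proof. by case: fr => _ h _ _ /h[]. Qed.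
Let Dom_lam A : D A -> Dom (lam A) = E. Proof. by case: fr => _ h _ _ /h[]. Qed.
Let Im_lam A : D A -> Im (lam A) = A. Proof. by case: fr => _ h _ _ /h[]. Qed.
Let DI a : a \in M -> D (Dom a) = D (Im a). Proof. by case: fr => _ _ h _; apply: h. Qed.
Let tlE a : a \in M -> D (Dom a) -> tl a = lam (Dom a) * a * (lam (Im a))^-1.
Proof. by case: fr => _ _ _ h; apply: h. Qed.

Lemma frame_card A : D A -> #|A| = #|E|.
Proof. by move=> DA; rewrite -(Im_lam DA) -card_Dom Dom_lam. Qed.

Lemma frame_bij A B : D A -> D B ->
  exists u, [/\ u \in M, Dom u = A & Im u = B].
Proof.
move=> DA DB; exists ((lam A)^-1 * lam B); split.
- by rewrite MM ?MV ?lamM.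
- by rewrite Dom_mul ?Dom_pinv ?Im_lam // Im_pinv !Dom_lam.
- by rewrite Im_mul ?Im_pinv ?Im_lam // !Dom_lam.
Qed.

Lemma tl_Hclass a : a \in M -> D (Dom a) -> tl a \in Hclass M (pid E).
Proof.
move=> Ma Da; have Di : D (Im a) by rewrite -DI.
rewrite HclassE tlE // !MM ?MV ?lamM //=.
have e : Im (lam (Dom a) * a) = Im a by rewrite Im_mul ?Im_lam.
rewrite Dom_mul ?Im_mul ?e ?Dom_pinv ?Im_lam // Im_pinv.
by rewrite Dom_mul ?Im_lam // !Dom_lam // !eqxx.
Qed.

Lemma tlK a : a \in M -> D (Dom a) ->
  (lam (Dom a))^-1 * tl a * lam (Im a) = a.
Proof.
move=> Ma Da; have Di : D (Im a) by rewrite -DI.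
rewrite tlE // !mulgA pmulVl -(mulgA _ _ (lam (Im a))) pmulVl !Im_lam //.
by rewrite pid_mul_id // mul_pid_id.
Qed.

(** The translating element depends only on z and on the image of a, so one w serves the whole
    H-class of a: this is multiplication in Brandt coordinates. *)
Lemma tl_mulr a z : a \in M -> z \in M -> D (Dom a) -> Im a \subset Dom z ->
  exists2 w, w \in Hclass M (pid E)
    & forall b, b \in M -> Dom b = Dom a -> Im b = Im a ->
      tl (b * z) = tl b * w.
Proof.
move=> Ma Mz Da az; have Di : D (Im a) by rewrite -DI.
have Daz : D (Im (a * z)) by rewrite -DI ?MM ?Dom_mul.
exists (lam (Im a) * z * (lam (Im (a * z)))^-1).
  rewrite HclassE !MM ?MV ?lamM //=.
  have Iz : Im (lam (Im a) * z) = Im (a * z) by apply: eq_Im_mul; rewrite Im_lam.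
  rewrite Dom_mul ?Dom_pinv ?Im_lam ?Iz //.
  rewrite Im_mul ?Dom_pinv ?Im_lam ?Iz // Im_pinv.
  by rewrite Dom_mul ?Im_lam // !Dom_lam // !eqxx.
move=> b Mb Db Ib.
have Dbz : Dom (b * z) = Dom a by rewrite Dom_mul ?Ib.
have Ibz : Im (b * z) = Im (a * z) by apply: eq_Im_mul.
rewrite !tlE ?MM ?Dbz ?Db // Ibz Ib !mulgA; congr (_ * _ * _).
by rewrite -[lam (Dom a) * b * _ * _]mulgA pmulVl Im_lam // -[_ * b * _]mulgA mul_pid_id // Ib.
Qed.

Lemma tl_mull a z : a \in M -> z \in M -> D (Dom a) -> Dom a \subset Im z ->
  exists2 w, w \in Hclass M (pid E)
    & forall b, b \in M -> Dom b = Dom a -> Im b = Im a ->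
      tl (z * b) = w * tl b.
Proof.
move=> Ma Mz Da az; have Di : D (Im a) by rewrite -DI.
have Dza : D (Dom (z * a)) by rewrite DI ?MM ?Im_mul.
exists (lam (Dom (z * a)) * z * (lam (Dom a))^-1).
  rewrite HclassE !MM ?MV ?lamM //=.
  have Iz : Dom (z * (lam (Dom a))^-1) = Dom (z * a).
    by apply: eq_Dom_mul; rewrite Dom_pinv Im_lam.
  rewrite -mulgA (@Dom_mul _ (lam _)) ?Iz ?Im_lam //.
  rewrite (@Im_mul _ (lam _)) ?Iz ?Im_lam // (@Im_mul _ z).
    by rewrite Im_pinv !Dom_lam // !eqxx.
  by rewrite Dom_pinv Im_lam.
move=> b Mb Db Ib.
have Dbz : Im (z * b) = Im a by rewrite Im_mul ?Db.
have Ibz : Dom (z * b) = Dom (z * a) by apply: eq_Dom_mul.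
rewrite !tlE ?MM ?Ibz ?Db // Dbz Ib !mulgA; congr (_ * _).
rewrite -[lam (Dom (z * a)) * z * _ * _]mulgA pmulVl Im_lam //.
by rewrite -[_ * pid _ * b]mulgA pid_mul_id ?Db.
Qed.

(** The collapsed ideal. It is kept abstract so that the same argument covers both [belowJ] and
    [notaboveJ]. *)
Variable I : {set pperm n}.
Hypothesis idealI : forall a z, a \in I -> z \in M -> z * a \in I /\ a * z \in I.
Hypothesis lowI : forall a, a \in M -> #|Im a| < #|E| -> a \in I.
Hypothesis disjI : forall a, a \in I -> ~~ D (Dom a).

Lemma collapseP rho p :
  reflect [/\ p.1 \in M, p.2 \in M &
     [\/ p.1 = p.2, p.1 \in I /\ p.2 \in I |
        [/\ D (Dom p.1), Dom p.1 = Dom p.2, Im p.1 = Im p.2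
          & (tl p.1, tl p.2) \in rho]]]
   (p \in collapse M I (classof D) tl rho).
Proof.
rewrite !inE; case: p => a b /=.
case Ma: (a \in M) => /=; last by constructor=> -[].
case Mb: (b \in M) => /=; last by constructor=> -[].
rewrite greenHE //; apply: (iffP or3P) => [h|[_ _ h]].
  split=> //; case: h => [/eqP ->|/andP[]|/and4P[Da _ /andP[/eqP ? /eqP ?] ?]].
  - by constructor 1.
  - by constructor 2.
  - by constructor 3.
case: h => [->|[-> ->]|[Da eD eI ->]]; [constructor 1|constructor 2|constructor 3] => //.
by rewrite -eD -eI Da !eqxx.
Qed.

(** Multiplying an H-related pair by z has the same effect on both members, since it depends only on
    their common domain or image: either the rank survives and both group coordinates are translated
    by the same element, or both ranks drop below that of E and both products lie in I. Transitivity
    uses that I misses the class. *)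
Lemma collapse_congruence rho :
  congruence (Hclass M (pid E)) rho ->
  congruence M (collapse M I (classof D) tl rho).
Proof.
move=> [rs [rr rsym rtr] rc].
split; [|split|].
- by apply/subsetP => p; rewrite inE => /andP[].
- by move=> a Ma; apply/collapseP; split=> //; constructor 1.
- move=> a b /collapseP[/= Ma Mb h]; apply/collapseP; split=> //=.
  case: h => [->|[]|[Da eD eI r]]; [constructor 1|constructor 2|constructor 3] => //.
  by rewrite -eD -eI; split=> //; apply: rsym.
- move=> a b c /collapseP[/= Ma Mb h] /collapseP[/= _ Mc k].
  apply/collapseP; split=> //=.
  case: h => [->//|[Ia Ib]|[Da eD eI r]].
    case: k => [<-|[_ Ic]|[Db]]; [by constructor 2|by constructor 2|].
    by move: (disjI Ib) => /negP.
  case: k => [<-|[Ib]|[Db eD' eI' r']]; [by constructor 3| |].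
    by move: (disjI Ib); rewrite -eD Da.
  by constructor 3; split; rewrite ?eD ?eI -?eD // ?eD //; apply: (rtr _ _ _ r r').
move=> a b z /collapseP[/= Ma Mb h] Mz; split; apply/collapseP => /=;
  split; rewrite ?MM //.
  case: h => [->|[Ia Ib]|[Da eD eI r]]; first by constructor 1.
    by constructor 2; case: (idealI Ia Mz); case: (idealI Ib Mz).
  case: (boolP (Dom a \subset Im z)) => az.
    have [w Hw tw] := tl_mull Ma Mz Da az.
    constructor 3; rewrite !tw // !Im_mul -?eD //.
    rewrite (eq_Dom_mul z (esym eD)) DI ?MM // Im_mul // -DI //; split=> //.
    by case: (rc _ _ _ r Hw).
  constructor 2; split; apply: lowI; rewrite ?MM // -(frame_card Da).
    by rewrite (card_Dom a) Im_mul_card.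
  by rewrite eD in az *; rewrite (card_Dom b) Im_mul_card.
case: h => [->|[Ia Ib]|[Da eD eI r]]; first by constructor 1.
  by constructor 2; case: (idealI Ia Mz); case: (idealI Ib Mz).
case: (boolP (Im a \subset Dom z)) => az.
  have [w Hw tw] := tl_mulr Ma Mz Da az.
  constructor 3; rewrite !tw // !Dom_mul -?eI // (eq_Im_mul z (esym eI)); split=> //.
  by case: (rc _ _ _ r Hw).
constructor 2; split; apply: lowI; rewrite ?MM // -(frame_card Da) -card_Dom.
  by rewrite Dom_mul_card.
by rewrite eI in az; rewrite eD Dom_mul_card.
Qed.

End Frame.

Lemma Hclass_mul E a b :
  a \in Hclass M (pid E) -> b \in Hclass M (pid E) -> a * b \in Hclass M (pid E).
Proof.
rewrite !HclassE => /and3P[Ma /eqP Da /eqP Ia] /and3P[Mb /eqP Db /eqP Ib].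
by rewrite MM // Dom_mul ?Im_mul ?Da ?Ib ?Ia ?Db // !eqxx.
Qed.

(** * The class of the empty map *)

Section Congruence.

Variable R : {set pperm n * pperm n}.
Hypothesis congR : congruence M R.

Let RM a b : (a, b) \in R -> a \in M /\ b \in M.
Proof. by case: congR => /subsetP s _ _ /s; rewrite inE => /andP. Qed.
Let Rrefl a : a \in M -> (a, a) \in R.
Proof. by case: congR => _ [h _ _] _; apply: h. Qed.
Let Rsym a b : (a, b) \in R -> (b, a) \in R.
Proof. by case: congR => _ [_ h _] _; apply: h. Qed.
Let Rtrans b a c : (a, b) \in R -> (b, c) \in R -> (a, c) \in R.
Proof. by case: congR => _ [_ _ h] _; apply: h. Qed.
Let RmulL a b z : (a, b) \in R -> z \in M -> (z * a, z * b) \in R.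
Proof. by case: congR => _ _ h r Mz; case: (h _ _ _ r Mz). Qed.
Let RmulR a b z : (a, b) \in R -> z \in M -> (a * z, b * z) \in R.
Proof. by case: congR => _ _ h r Mz; case: (h _ _ _ r Mz). Qed.

(** [pid set0] is the zero of M, so this class is an ideal. By [zeroclass_Dom] and [zeroclass_sub]
    it is determined by a family of sets closed under taking subsets. *)
Definition zeroclass : {set pperm n} := [set a | (a, pid set0) \in R].
Local Notation Z := zeroclass.

Lemma zeroclassM a : a \in Z -> a \in M.
Proof. by rewrite inE => /RM[]. Qed.

Lemma zeroclass_rel a b : a \in Z -> b \in Z -> (a, b) \in R.
Proof. by rewrite !inE => ra /Rsym; apply: Rtrans. Qed.

Lemma zeroclass_cl a b : (a, b) \in R -> b \in Z -> a \in Z.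
Proof. by rewrite !inE; apply: Rtrans. Qed.

Lemma zeroclass0 : pid set0 \in Z.
Proof. by rewrite inE Rrefl. Qed.

Lemma zeroclass_mull a z : z \in M -> a \in Z -> z * a \in Z.
Proof.
rewrite !inE => Mz r; have := RmulL r Mz.
rewrite (_ : z * pid set0 = pid set0) //.
by apply: ppermPS => x y; rewrite mul_pid pidP !inE; split=> [] [].
Qed.

Lemma zeroclass_mulr a z : z \in M -> a \in Z -> a * z \in Z.
Proof.
rewrite !inE => Mz r; have := RmulR r Mz.
rewrite (_ : pid set0 * z = pid set0) //.
by apply: ppermPS => x y; rewrite pid_mul pidP !inE; split=> [] [].
Qed.

Lemma zeroclass_Dom a : a \in M -> (pid (Dom a) \in Z) = (a \in Z).
Proof.
move=> Ma; apply/idP/idP => [/(zeroclass_mulr Ma)|/(zeroclass_mulr (MV Ma))].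
  by rewrite pid_mul_id.
by rewrite pmulV.
Qed.

Lemma zeroclass_Im a : a \in M -> (pid (Im a) \in Z) = (a \in Z).
Proof.
move=> Ma; apply/idP/idP => [/(zeroclass_mull Ma)|/(zeroclass_mull (MV Ma))].
  by rewrite mul_pid_id.
by rewrite pmulVl.
Qed.

Lemma zeroclass_sub A B : A \subset B -> pid B \in Z -> pid A \in Z.
Proof.
by move=> /setIidPl sAB /(zeroclass_mull (Mid A)); rewrite pidM sAB.
Qed.

(** A weak form of transitivity: a single y is required, because for A = [setT] in the two-class
    case the points x and y must have the same parity. *)
Definition swappable := forall A x, x \in A -> A != [set x] ->
  exists y u, [/\ y \in A, y != x, u \in M, Dom u = A :\ x & Im u = A :\ y].

Hypothesis swapM : swappable.

(* By swappability [pid (A :\ x)] is J-equivalent to some [pid (A :\ y)], and   *)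
(* the latter is related to [pid (A :\ y :\ x)]: induct on the rank.           *)
Lemma zeroclass_drop A x : x \in A -> (pid A, pid (A :\ x)) \in R -> pid A \in Z.
Proof.
have [m] := ubnP #|A|; elim: m A x => // m IH A x lt_m Ax Rx.
have [A1|nA1] := eqVneq A [set x].
  by move: Rx; rewrite inE A1 setDv.
have [y [u [Ay nyx Mu Du Iu]]] := swapM Ax nA1.
have Zy : pid (A :\ y) \in Z.
  apply: (IH _ x); first by rewrite (cardsD1 y) Ay in lt_m.
    by rewrite !inE eq_sym nyx.
  have := RmulR Rx (Mid (A :\ y)); rewrite !pidM.
  rewrite (setIidPr (subD1set A y)) (_ : _ :&: _ = A :\ y :\ x) //.
  by apply/setP => z; rewrite !inE; case: (z \in A); rewrite ?andbF ?andbT.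
apply: zeroclass_cl Rx _.
by rewrite -Du zeroclass_Dom // -zeroclass_Im // Iu.
Qed.

(** If b is undefined at x in Dom a, then b cannot distinguish [pid (Dom a)] from
    [pid (Dom a :\ x)]. Hence a is related to its restriction away from x, and multiplying by a^-1
    relates the two partial identities, as [zeroclass_drop] requires. *)
Lemma zeroclass_Dom_sub a b :
  (a, b) \in R -> ~~ (Dom a \subset Dom b) -> a \in Z.
Proof.
move=> r /subsetPn[x ax bx]; have [Ma Mb] := RM r.
rewrite -zeroclass_Dom //; apply: (zeroclass_drop ax).
have eb : pid (Dom a) * b = pid (Dom a :\ x) * b.
  apply: ppermPS => y z; rewrite !pid_mul in_setD1.
  split=> [[-> bz]|[/andP[_ ->] ->] //]; rewrite bz andbT; split=> //.
  by apply: contraNneq bx => <-; apply: mem_Dom bz.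
have := RmulL r (Mid (Dom a)); rewrite eb pid_mul_id // => r'.
have r2 : (a, pid (Dom a :\ x) * a) \in R.
  by apply: Rtrans r' _; apply/Rsym/RmulL.
have := RmulR r2 (MV Ma).
by rewrite -mulgA pmulV pidM (setIidPl (subD1set _ _)).
Qed.

Lemma zeroclass_Im_sub a b :
  (a, b) \in R -> ~~ (Im a \subset Im b) -> a \in Z.
Proof.
move=> r /subsetPn[x ax bx]; have [Ma Mb] := RM r.
rewrite -zeroclass_Im //; apply: (zeroclass_drop ax).
have eb : b * pid (Im a) = b * pid (Im a :\ x).
  apply: ppermPS => y z; rewrite !mul_pid in_setD1.
  split=> [[-> bz]|[/andP[_ ->] ->] //]; rewrite bz andbT; split=> //.
  by apply: contraNneq bx => <-; apply: mem_Im bz.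
have := RmulR r (Mid (Im a)); rewrite eb mul_pid_id // => r'.
have r2 : (a, a * pid (Im a :\ x)) \in R.
  by apply: Rtrans r' _; apply/Rsym/RmulR.
have := RmulL r2 (MV Ma).
by rewrite mulgA pmulVl pidM (setIidPr (subD1set _ _)).
Qed.

(** Each of the four inclusions between domains and between images can fail only for a pair inside
    Z. *)
Lemma congruence_zero_or_H a b : (a, b) \in R ->
  (a \in Z /\ b \in Z) \/ (Dom a = Dom b /\ Im a = Im b).
Proof.
move=> r; have r' := Rsym r.
have h c d : (c, d) \in R -> c \in Z -> c \in Z /\ d \in Z.
  by move=> cd Zc; split=> //; apply: zeroclass_cl (Rsym cd) Zc.
case: (boolP (Dom a \subset Dom b)) => [s1|/(zeroclass_Dom_sub r)/(h _ _ r)]; last by left.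
case: (boolP (Dom b \subset Dom a)) => [s2|/(zeroclass_Dom_sub r')/(h _ _ r')[]]; last by left.
case: (boolP (Im a \subset Im b)) => [s3|/(zeroclass_Im_sub r)/(h _ _ r)]; last by left.
case: (boolP (Im b \subset Im a)) => [s4|/(zeroclass_Im_sub r')/(h _ _ r')[]]; last by left.
by right; split; apply/eqP; rewrite eqEsubset ?s1 ?s3.
Qed.

(** Restrict both maps to Dom a minus x. If a and b are H-related, the restrictions omit different
    points of the common image, so they are no longer H-related and must lie in Z. *)
Lemma zeroclass_moved a b x : (a, b) \in R -> x \in Dom a -> a x <> b x ->
  pid (Dom a :\ x) \in Z.
Proof.
move=> r ax nab; have [Ma Mb] := RM r.
have e c : c \in M -> Dom c = Dom a -> Dom (pid (Dom a :\ x) * c) = Dom a :\ x.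
  by move=> Mc ec; rewrite Dom_pid_mul ec (setIidPl (subD1set _ _)).
have mZ c : c \in M -> Dom c = Dom a ->
    (pid (Dom a :\ x) * c \in Z) -> pid (Dom a :\ x) \in Z.
  move=> Mc ec Zc; rewrite -(e c Mc ec) zeroclass_Dom //; exact: MM.
case: (congruence_zero_or_H (RmulL r (Mid (Dom a :\ x)))) => [[Za _]|[_ eI]].
  exact: mZ Ma erefl Za.
case: (congruence_zero_or_H r) => [[Za _]|[eD eI']].
  by apply: zeroclass_sub (subD1set _ _) _; rewrite zeroclass_Dom.
move/DomP: (ax) => [y axy].
have /DomP[y' bxy'] : x \in Dom b by rewrite -eD.
move: eI; rewrite (Im_pid_mul1 axy) {1}eD (Im_pid_mul1 bxy') eI' => /setP/(_ y).
rewrite !in_setD1 eqxx /= => /esym/negbT; rewrite negb_and negbK -eI' (mem_Im axy).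
by rewrite orbF => /eqP e'; case: nab; rewrite axy bxy' e'.
Qed.

Lemma zeroclass_moved_ex a b : (a, b) \in R -> a <> b -> a \notin Z ->
  exists2 x, x \in Dom a & a x <> b x.
Proof.
move=> r nab nZ; case: (congruence_zero_or_H r) => [[Za]|[eD _]].
  by rewrite Za in nZ.
have [/forallP h|] := boolP [forall x, a x == b x].
  by case: nab; apply: ppermP => x; apply/eqP.
rewrite negb_forall => /existsP[x nx]; exists x; last exact/eqP.
rewrite inE; apply: contra nx => /eqP ax.
have : x \notin Dom b by rewrite -eD inE ax.
by rewrite inE negbK ax => /eqP ->.
Qed.

Definition restrict E := R :&: setX (Hclass M (pid E)) (Hclass M (pid E)).

Lemma restrict_congruence E : congruence (Hclass M (pid E)) (restrict E).
Proof.
have HM c : c \in Hclass M (pid E) -> c \in M by rewrite HclassE => /and3P[].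
split; [by rewrite subsetIr|split|].
- by move=> a Ha; rewrite inE Rrefl ?HM // inE Ha.
- by move=> a b; rewrite !inE => /andP[/Rsym-> /andP[-> ->]].
- move=> a b c; rewrite !inE => /andP[/Rtrans r /andP[-> _]] /andP[/r-> /andP[_ ->]].
  by [].
move=> a b c /setIP[r /setXP[Ha Hb]] Hc; split; apply/setIP.
  by rewrite RmulL ?HM // inE !Hclass_mul.
by rewrite RmulR ?HM // inE !Hclass_mul.
Qed.

Section Classification.

Variables (D : pred {set 'I_n}) (E : {set 'I_n}) (tl : pperm n -> pperm n).
Variable lam : {set 'I_n} -> pperm n.
Hypothesis fr : frame_by D E tl lam.

(** Passing to group coordinates multiplies both members by the same elements of M, and [tlK] undoes
    it by multiplication as well, so R is carried in both directions. *)
Lemma restrict_tl a b : a \in M -> b \in M -> D (Dom a) ->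
  Dom a = Dom b -> Im a = Im b ->
  ((tl a, tl b) \in restrict E) = ((a, b) \in R).
Proof.
move=> Ma Mb Da eD eI; have Db : D (Dom b) by rewrite -eD.
rewrite inE [_ \in setX _ _]inE /= !(tl_Hclass fr) // !andbT.
case: (fr) => _ lamP DI tlE.
have [Ml _ _] := lamP _ Da; have [|Ml' _ _] := lamP (Im a); first by rewrite -DI.
apply/idP/idP => r.
  have := RmulR (RmulL r (MV Ml)) Ml'.
  by rewrite (tlK fr) // eD eI (tlK fr).
by rewrite !tlE // -eD -eI RmulR ?MV // RmulL.
Qed.

(** All or nothing: Z is an ideal and the frame joins the domains of a and b by an element of M. *)
Lemma zeroclass_frame a b : a \in M -> b \in M -> D (Dom a) -> D (Dom b) ->
  a \in Z -> b \in Z.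
Proof.
move=> Ma Mb Da Db; rewrite -zeroclass_Dom // -(zeroclass_Dom Mb) => Za.
have [u [Mu <- Iu]] := frame_bij fr Db Da.
by rewrite zeroclass_Dom // -zeroclass_Im // Iu.
Qed.

(** The converse of [collapse_congruence]: once all nontrivial pairs outside Z live in one framed
    class, R is recovered from Z and from its trace on the group H-class of [pid E]. *)
Lemma congruence_collapse (I : {set pperm n}) : I = Z ->
  (forall a b, (a, b) \in R -> a <> b -> a \notin Z -> D (Dom a)) ->
  R = collapse M I (classof D) tl (restrict E).
Proof.
move=> -> h; apply/setP => -[a b]; apply/idP/collapseP => /= [r|[Ma Mb]].
  have [Ma Mb] := RM r; split=> //.
  have [->|/eqP nab] := eqVneq a b; first by constructor 1.
  have [Za|nZ] := boolP (a \in Z).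
    by constructor 2; split=> //; apply: zeroclass_cl (Rsym r) Za.
  have Da := h _ _ r nab nZ.
  case: (congruence_zero_or_H r) => [[Za]|[eD eI]]; first by rewrite Za in nZ.
  by constructor 3; rewrite restrict_tl.
case=> [->|[Za Zb]|[Da eD eI]]; [exact: Rrefl|exact: zeroclass_rel|].
by rewrite restrict_tl.
Qed.

End Classification.
End Congruence.
End InverseSubmonoid.

(** * Ranks *)

Lemma ex_subset_card (T : finType) (A : {set T}) k :
  k <= #|A| -> exists2 B : {set T}, B \subset A & #|B| = k.
Proof.
move=> leA; exists [set x in take k (enum A)].
  by apply/subsetP => x; rewrite inE => /mem_take; rewrite mem_enum.
rewrite cardsE; have /card_uniqP-> : uniq (take k (enum A)) by rewrite take_uniq ?enum_uniq.
by rewrite size_takel // -cardE.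
Qed.

Lemma ex_supset_card (T : finType) (A : {set T}) k :
  #|A| <= k <= #|T| -> exists2 B : {set T}, A \subset B & #|B| = k.
Proof.
move=> /andP[lo hi].
have [|B sB cB] := @ex_subset_card _ (~: A) (#|T| - k); first by rewrite -(cardsC A); lia.
exists (~: B); first by rewrite -setCS setCK.
by have := cardsC B; lia.
Qed.

Section Missing.

Variable n : nat.
Implicit Types (A : {set 'I_n}) (x : 'I_n).

Lemma missingC1 x : missing [set~ x] = label x.
Proof.
rewrite /missing; case: pickP => [y|/(_ x)]; rewrite !inE; last by rewrite eqxx.
by rewrite negbK => /eqP->.
Qed.

Lemma card_le_n A : #|A| <= n.
Proof. by rewrite (leq_trans (max_card _)) ?card_ord. Qed.

Lemma cardC1n x : #|[set~ x]| = n - 1.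
Proof. by have := cardsC [set x]; rewrite cards1 card_ord; lia. Qed.

Lemma card_n1P A : 0 < n -> #|A| = n - 1 -> exists x, A = [set~ x].
Proof.
move=> n0 cA; have /cards1P[x ex] : #|~: A| == 1%N.
  by have := cardsC A; rewrite card_ord cA; lia.
by exists x; rewrite -ex setCK.
Qed.

End Missing.

Section RankClasses.

Variables (n : nat) (M : {set pperm n}).
Hypothesis invM : inverse_submonoid M.
Implicit Types (a b c u v z : pperm n) (x y : 'I_n) (A B E : {set 'I_n})
  (rho R : {set pperm n * pperm n}).

Let MM a b : a \in M -> b \in M -> a * b \in M.
Proof. by case: invM => h _ _; apply: h. Qed.
Let Mid A : pid A \in M. Proof. by case: invM. Qed.

Definition has_card (k : nat) : pred {set 'I_n} := fun A => #|A| == k.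

Definition ranklt k : {set pperm n} := [set a in M | #|Im a| < k].

Lemma rankJ_classof k : rankJ M k = classof M (has_card k).
Proof. by apply/setP => a; rewrite !inE /has_card card_Dom. Qed.

Lemma rankltM k : ranklt k \subset M.
Proof. by apply/subsetP => a; rewrite inE => /andP[]. Qed.

Lemma ranklt_ideal k a z : a \in ranklt k -> z \in M ->
  z * a \in ranklt k /\ a * z \in ranklt k.
Proof.
rewrite !inE => /andP[Ma lt_a] Mz; rewrite !MM //=; split.
  by rewrite (leq_ltn_trans _ lt_a) // subset_leq_card // Im_mul_sub.
by rewrite (leq_ltn_trans _ lt_a) // -!card_Dom subset_leq_card // Dom_mul_sub.
Qed.

(** Rank is monotone along the J-order, and an element of rank at least k lies above its restriction
    to k points of its domain. *)
Lemma notaboveJ_rank k : notaboveJ M (rankJ M k) = ranklt k.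
Proof.
apply/setP => a; rewrite !inE; case Ma: (a \in M) => //=.
rewrite ltnNge; congr (~~ _); apply/(leJP invM)/idP => [[b [c [+ /(JclassP invM)[]]]]|le_k].
  rewrite inE => /andP[_ /eqP <-] _ ca _ /ideal_card le_bc.
  exact: leq_trans le_bc (ideal_card ca).
rewrite -card_Dom in le_k; have [B sB cB] := ex_subset_card le_k.
exists (pid B * a), a; split.
- by rewrite inE MM // -card_Dom Dom_pid_mul (setIidPl sB) cB eqxx.
- by apply/(JclassP invM); rewrite Ma ?ideal_id.
by apply/idealP; exists (pid B), (pid setT); rewrite !Mid mulg1.
Qed.

Lemma piJ_rank_congruence k E tl rho : frame M (has_card k) E tl ->
  congruence (Hclass M (pid E)) rho -> congruence M (piJ M (rankJ M k) tl rho).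
Proof.
move=> [lam fr] cr; rewrite /piJ notaboveJ_rank rankJ_classof.
have /eqP cE : has_card k E by case: fr.
apply: (collapse_congruence invM fr) => //.
- exact: ranklt_ideal.
- by move=> a Ma; rewrite cE inE Ma.
- by move=> a; rewrite inE /has_card card_Dom => /andP[_ h]; rewrite neq_ltn h.
Qed.

Lemma universal_congruence : congruence M (setX M M).
Proof.
split=> //.
  split; [by move=> a Ma; rewrite inE Ma| |].
    by move=> a b /setXP[Ma Mb]; rewrite inE Ma Mb.
  by move=> a b c /setXP[Ma Mb] /setXP[_ Mc]; rewrite inE Ma Mc.
by move=> a b z /setXP[Ma Mb] Mz; rewrite !inE /= !MM.
Qed.

Section Congruence.

Variable R : {set pperm n * pperm n}.
Hypothesis congR : congruence M R.
Hypothesis swapM : swappable M.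

Local Notation Z := (zeroclass R).

Lemma zeroclass_unit : pid setT \in Z -> R = setX M M.
Proof.
move=> ZT; have MZ a : a \in M -> a \in Z.
  by move=> Ma; rewrite -(mul1g a); apply: (zeroclass_mulr congR).
apply/eqP; rewrite eqEsubset; case: (congR) => -> _ _ /=.
apply/subsetP => -[a b] /setXP[Ma Mb].
by apply: (zeroclass_rel congR); apply: MZ.
Qed.

(** Shrink A to a k-set, carry it by the frame to a k-set containing Dom a, and shrink again. *)
Lemma zeroclass_rank k E tl A : frame M (has_card k) E tl -> k <= n ->
  pid A \in Z -> k <= #|A| -> forall a, a \in M -> #|Im a| <= k -> a \in Z.
Proof.
move=> [lam fr] le_n ZA leA a Ma le_a.
have [B sB cB] := ex_subset_card leA.
have [|C sC cC] := @ex_supset_card _ (Dom a) k; first by rewrite card_Dom le_a card_ord.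
rewrite -(zeroclass_Dom invM congR) //; apply: (zeroclass_sub invM congR sC).
have ZB := zeroclass_sub invM congR sB ZA.
by apply: (zeroclass_frame invM congR fr (Mid B)) => //; rewrite Dom_pid /has_card ?cB ?cC eqxx.
Qed.

Lemma pair_rank a b : (a, b) \in R -> a <> b -> a \notin Z ->
  exists2 A, pid A \in Z & #|Im a| = #|A|.+1.
Proof.
move=> r nab nZ; have [x ax nx] := zeroclass_moved_ex invM congR swapM r nab nZ.
exists (Dom a :\ x); first exact: (zeroclass_moved invM congR swapM r ax nx).
by rewrite -card_Dom (cardsD1 x) ax.
Qed.

(** Take for k the least rank of an element outside Z; it is positive because the only map of rank 0
    is the zero. *)
Lemma zeroclass_level : pid setT \notin Z -> exists k,
  [/\ 0 < k <= n, ranklt k \subset Z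
    & exists a, [/\ a \in M, #|Im a| = k & a \notin Z]].
Proof.
move=> nZ; pose P k := [exists a in M, (#|Im a| == k) && (a \notin Z)].
have exP : exists k, P k.
  by exists n; apply/exists_inP; exists (pid setT); rewrite ?Mid // Im_pid cardsT card_ord eqxx.
case: (ex_minnP exP) => k /exists_inP[a Ma /andP[/eqP ka nZa]] mink.
exists k; split; last by exists a.
  rewrite -{2}ka card_le_n andbT lt0n; apply: contra nZa => /eqP k0.
  have a0 : a = pid set0.
    have /eqP : #|Dom a| = 0 by rewrite card_Dom ka.
    rewrite cards_eq0 => /eqP D0; apply: ppermPS => x y; rewrite pidP !inE.
    by split=> [/mem_Dom|[]//]; rewrite D0 inE.
  by rewrite a0 (zeroclass0 invM congR).
apply/subsetP => b; rewrite inE => /andP[Mb lt_b]; apply: contraLR lt_b => nZb.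
by rewrite -leqNgt mink //; apply/exists_inP; exists b; rewrite ?eqxx.
Qed.

(** With a single class in rank k, Z is exactly the set of elements of smaller rank. By [pair_rank]
    a nontrivial pair outside Z has rank one more than some member of Z, hence rank exactly k. *)
Lemma classify_rank k E tl : frame M (has_card k) E tl -> 0 < k <= n ->
  ranklt k \subset Z -> (exists a, [/\ a \in M, #|Im a| = k & a \notin Z]) ->
  exists2 rho, congruence (Hclass M (pid E)) rho & R = piJ M (rankJ M k) tl rho.
Proof.
move=> fr /andP[k0 kn] sub [a0 [Ma0 ka0 nZ0]].
have low A : pid A \in Z -> #|A| < k.
  move=> ZA; rewrite ltnNge; apply: contra nZ0 => leA.
  by apply: (zeroclass_rank fr kn ZA leA); rewrite ?ka0.
have eZ : ranklt k = Z.
  apply/eqP; rewrite eqEsubset sub; apply/subsetP => a Za.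
  have Ma := zeroclassM congR Za.
  by rewrite inE Ma low // (zeroclass_Im invM congR).
exists (restrict M R E); first exact: restrict_congruence.
case: fr => lam fr; rewrite /piJ notaboveJ_rank rankJ_classof.
apply: (congruence_collapse invM congR swapM fr) => // a b r nab nZ.
have [A ZA cA] := pair_rank r nab nZ; apply/eqP; rewrite card_Dom.
move: nZ; rewrite -eZ inE.
have -> : a \in M by case: congR => /subsetP/(_ _ r); rewrite inE => /andP[].
by move: (low _ ZA); lia.
Qed.

End Congruence.
End RankClasses.

Lemma swappable_card n (M : {set pperm n}) A x :
  inverse_submonoid M ->
  (exists E tl, frame M (@has_card n #|A :\ x|) E tl) ->
  x \in A -> A != [set x] ->
  exists y u, [/\ y \in A, y != x, u \in M, Dom u = A :\ x & Im u = A :\ y].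
Proof.
move=> invM [E [tl [lam fr]]] Ax nA.
have /set0Pn[y] : A :\ x != set0.
  by apply: contra nA; rewrite setD_eq0 => sA; rewrite eqEsubset sA sub1set.
rewrite !inE => /andP[nyx Ay].
have [||u [Mu Du Iu]] := frame_bij invM fr (A := A :\ x) (B := A :\ y).
- by rewrite /has_card.
- by rewrite /has_card; have := cardsD1 x A; have := cardsD1 y A; rewrite Ax Ay; lia.
by exists y, u.
Qed.

(** * One J-class in every rank *)

Section OneClassPerRank.

Variables (n : nat) (M : {set pperm n}).
Hypothesis invM : inverse_submonoid M.
Hypothesis frames : forall k, 1 <= k <= n ->
  frame M (@has_card n k) (seg 1 k) (tilde k).

Lemma congruences_one_class R : congruence M R <->
  R = setX M M \/
  exists k rho, [/\ 1 <= k <= n, congruence (Hclass M (pid (seg 1 k))) rho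
                  & R = piJ M (rankJ M k) (tilde k) rho].
Proof.
split=> [cR|[->|[k [rho [hk cr ->]]]]]; last 2 first.
- exact: universal_congruence.
- exact: (piJ_rank_congruence invM (frames hk)).
have sw : swappable M.
  move=> A x Ax nA; apply: (swappable_card invM) => //.
  exists (seg 1 #|A :\ x|), (tilde #|A :\ x|); apply: frames.
  rewrite card_le_n andbT lt0n cards_eq0.
  by apply: contra nA; rewrite setD_eq0 => sA; rewrite eqEsubset sA sub1set.
have [ZT|nZT] := boolP (pid setT \in zeroclass R); first by left; apply: zeroclass_unit.
right; have [k [hk sk ak]] := zeroclass_level invM cR nZT.
have [rho cr eR] := classify_rank invM cR sw (frames hk) hk sk ak.
by exists k, rho.
Qed.

End OneClassPerRank.

(** * Two classes of rank n - 1 *)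

Section TwoClassesOfCorank1.

Variables (n : nat) (M : {set pperm n}).
Hypothesis n_ge4 : 4 <= n.
Hypothesis invM : inverse_submonoid M.
Implicit Types (a b c u v z : pperm n) (x y : 'I_n) (A B : {set 'I_n}) (p : bool)
  (rho R : {set pperm n * pperm n}).

(** The boolean p is the parity of the label of the missing point: [true] for the odd class, [false]
    for the even one. *)
Definition corank1 p : pred {set 'I_n} :=
  fun A => (#|A| == n - 1) && (odd (missing A) == p).

Variables (E : bool -> {set 'I_n}) (tl : bool -> pperm n -> pperm n).

Hypothesis frames : forall k, 1 <= k <= n - 2 \/ k = n ->
  frame M (@has_card n k) (seg 1 k) (tilde k).
Hypothesis frames1 : forall p, frame M (corank1 p) (E p) (tl p).
Hypothesis rigid : forall p a b, a \in M -> b \in M ->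
  Dom a = setT -> Dom b = setT ->
  (forall x, odd (label x) = p -> a x = b x) -> a = b.

Local Notation J p := (classof M (corank1 p)).

Let MM a b : a \in M -> b \in M -> a * b \in M.
Proof. by case: invM => h _ _; apply: h. Qed.
Let Mid A : pid A \in M. Proof. by case: invM. Qed.

Let lt_pred m : m < n -> m <= n - 1. Proof. by lia. Qed.
Let lt_pred2 m : m < n - 1 -> m <= n - 2. Proof. by lia. Qed.
Let lt_pred3 m : m.+1 < n -> m <= n - 2. Proof. by lia. Qed.
Let lt_trans1 m : m < n - 1 -> m < n. Proof. by lia. Qed.

Lemma corank1C x : corank1 (odd (label x)) [set~ x].
Proof. by rewrite /corank1 cardC1n missingC1 !eqxx. Qed.

Lemma ex_label p : exists x : 'I_n, odd (label x) = p.
Proof.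
have n0 : 0 < n by lia. have n1 : 1 < n by lia.
by case: p; [exists (Ordinal n0)|exists (Ordinal n1)].
Qed.

(** Write a = u b v. Equality of ranks forces Dom a = Dom (u b) and Im (u b) = Im b, and the frame
    says that an element of M has its domain and its image in the same class. So the two classes of
    rank n - 1 are incomparable. *)
Lemma corank1_ideal p a b : a \in ideal M b -> corank1 p (Dom a) ->
  #|Im b| <= n - 1 -> b \in M -> corank1 p (Dom b).
Proof.
move=> /idealP[u [v [Mu Mv ea]]] Da rb Mb.
have [lam [_ _ DI _]] := frames1 p.
have ca : #|Dom a| = n - 1 by case/andP: Da => /eqP.
have le1 : #|Dom (u * b * v)| <= #|Dom (u * b)| := subset_leq_card (Dom_mul_sub _ _).
have le2 : #|Im (u * b)| <= #|Im b| := subset_leq_card (Im_mul_sub _ _).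
have := card_Dom (u * b); rewrite -ea ca in le1 => e.
have eD : Dom a = Dom (u * b).
  by apply/eqP; rewrite eqEcard {1}ea Dom_mul_sub ca; lia.
have eI : Im (u * b) = Im b by apply/eqP; rewrite eqEcard Im_mul_sub; lia.
by rewrite DI // -eI -DI ?MM // -eD.
Qed.

Lemma oddJ_classof : oddJ M = J true.
Proof.
apply/setP => a; rewrite !inE /corank1 card_Dom /missing_dom -andbA.
by case: odd.
Qed.

Lemma evenJ_classof : evenJ M = J false.
Proof.
apply/setP => a; rewrite !inE /corank1 card_Dom /missing_dom -andbA.
by case: odd.
Qed.

(** Above the class p lie only the class itself and the units: a unit restricts to the complement of
    any point of parity p, and [corank1_ideal] excludes the other class of rank n - 1. *)
Lemma notaboveJ_corank1 p :
  notaboveJ M (J p) = [set a in M | (#|Im a| < n) && ~~ corank1 p (Dom a)].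
Proof.
apply/setP => a; rewrite !inE; case Ma: (a \in M) => //=.
rewrite ltnNge -negb_or; congr (~~ _); apply/(leJP invM)/idP.
  move=> [b [c [+ /(JclassP invM)[Mc ca ac]] bc]].
  rewrite inE => /andP[Mb Db]; case: (leqP n) => //= lt_a.
  have le_c := ideal_card ac; have le_a := lt_pred lt_a.
  apply: (corank1_ideal (b := a) (a := b)) => //.
  exact: (ideal_trans invM bc ca).
case: (boolP (corank1 p (Dom a))) => [Da _|_].
  exists a, a; rewrite ideal_id // inE Ma Da; split=> //.
  by apply/(JclassP invM); rewrite Ma ?ideal_id.
rewrite orbF => le_n; have [x px] := ex_label p.
exists (pid [set~ x] * a), a; split.
- rewrite inE MM // Dom_pid_mul (_ : Dom a = setT) ?setIT -?px ?corank1C //.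
  by apply/eqP; rewrite eqEcard subsetT cardsT card_ord card_Dom.
- by apply/(JclassP invM); rewrite Ma ?ideal_id.
by apply/idealP; exists (pid [set~ x]), (pid setT); rewrite !Mid mulg1.
Qed.

(** An element of rank n - 1 below the class has its own J-class equal to it, hence is not strictly
    below. An element of smaller rank can be moved, by the frame of its rank, inside the complement
    of a point of parity p. *)
Lemma belowJ_corank1 p : belowJ M (J p) = ranklt M (n - 1).
Proof.
have [lam fr] := frames1 p.
apply/setP => a; rewrite !inE; case Ma: (a \in M) => //=.
apply/andP/idP => [[/(leJP invM)[b [c [/(JclassP invM)[Mb ba ab]]]]]|lt_a].
  rewrite inE => /andP[Mc Dc] bc ne.
  have ac := ideal_trans invM ab bc.
  have cc : #|Im c| = n - 1 by rewrite -card_Dom; case/andP: Dc => /eqP.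
  have := ideal_card ac; rewrite cc leq_eqVlt => /orP[/eqP ca|//].
  case/eqP: ne; apply/setP => d.
  have Da : corank1 p (Dom a).
    have [q Dq] : exists q, corank1 q (Dom a).
      by exists (odd (missing (Dom a))); rewrite /corank1 card_Dom ca !eqxx.
    have := corank1_ideal ac Dq; rewrite cc => /(_ (leqnn _) Mc) /andP[_ /eqP eq].
    by case/andP: Dc Dq => _ /eqP <-; rewrite eq.
  apply/(JclassP invM)/idP => [[Md da ad]|].
    rewrite inE Md /=; apply: corank1_ideal ad Da _ Md.
    by rewrite -ca (ideal_card da).
  rewrite inE => /andP[Md Dd]; split=> //.
    have [u [Mu Du Iu]] := frame_bij invM fr Dd Da.
    have [_ MV _] := invM.
    apply/idealP; exists u, (a^-1 * u^-1 * d); rewrite Mu !MM ?MV //; split=> //.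
    by rewrite !mulgA -(mulgA u) pmulV -Iu (mul_pid_id (subxx _)) pmulV Du pid_mul_id.
  have [u [Mu Du Iu]] := frame_bij invM fr Da Dd.
  have [_ MV _] := invM.
  apply/idealP; exists u, (d^-1 * u^-1 * a); rewrite Mu !MM ?MV //; split=> //.
  by rewrite !mulgA -(mulgA u) pmulV -Iu (mul_pid_id (subxx _)) pmulV Du pid_mul_id.
split.
  have [x px] := ex_label p.
  have le : #|Dom a| <= #|[set~ x]| by rewrite cardC1n card_Dom (ltnW lt_a).
  have [B sB cB] := ex_subset_card le.
  (* The available frames start at rank 1, so the empty map is treated apart: as a zero it equals a
     e a for every e. *)
  have [a0|a_gt0] := posnP #|Im a|.
    apply/(leJP invM); exists a, (pid [set~ x]); split.
    - by apply/(JclassP invM); rewrite Ma ?ideal_id.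
    - by rewrite inE Mid Dom_pid -px corank1C.
    apply/idealP; exists a, a; split=> //.
    have nul y : y \notin Dom a.
      by move/eqP: a0; rewrite -card_Dom cards_eq0 => /eqP ->; rewrite inE.
    apply: ppermPS => y z; split=> [/mem_Dom|/pmulP[w /pmulP[t /mem_Dom]]];
      by rewrite (negPf (nul _)).
  have [|lamk frk] := @frames #|Dom a|; first by left; rewrite card_Dom; apply/andP; split; [exact: a_gt0|exact: lt_pred2].
  have [|u [Mu Du Iu]] := frame_bij invM frk (A := Dom a) (B := B) (eqxx _).
    by rewrite /has_card cB.
  have [_ MV _] := invM.
  apply/(leJP invM); exists a, (pid [set~ x]); split.
  - by apply/(JclassP invM); rewrite Ma ?ideal_id.
  - by rewrite inE Mid Dom_pid -px corank1C.
  apply/idealP; exists u, (u^-1 * a); rewrite MM ?MV //; split=> //.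
  by rewrite !mulgA mul_pid_id ?Iu // pmulV Du pid_mul_id.
apply: contraTneq lt_a => ea.
have : a \in Jclass M a by apply/(JclassP invM); rewrite Ma ?ideal_id.
by rewrite ea inE Ma /= => /andP[/eqP]; rewrite card_Dom => -> _; rewrite ltnn.
Qed.

Lemma corank1_card p A : corank1 p A -> #|A| = n - 1.
Proof. by case/andP => /eqP. Qed.

Lemma piJ_corank1_congruence p rho : congruence (Hclass M (pid (E p))) rho ->
  congruence M (piJ M (J p) (tl p) rho).
Proof.
move=> cr; have [lam fr] := frames1 p; have [DE _ DI _] := fr.
have cE := corank1_card DE.
rewrite /piJ notaboveJ_corank1; apply: (collapse_congruence invM fr) => //.
- move=> a z; rewrite !inE => /and3P[Ma lt_a nD] Mz; rewrite !MM //=.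
  have iz : z * a \in ideal M a.
    by apply/idealP; exists z, (pid setT); rewrite Mz Mid mulg1.
  have iz' : a * z \in ideal M a.
    by apply/idealP; exists (pid setT), z; rewrite Mz Mid mul1g.
  have := ideal_card iz; have := ideal_card iz' => l l'.
  have h c : c \in ideal M a -> ~~ corank1 p (Dom c).
    by move=> ca; apply: contra nD => /(corank1_ideal ca); apply=> //; exact: lt_pred.
  by rewrite !h // !andbT (leq_ltn_trans l' lt_a) (leq_ltn_trans l lt_a).
- move=> a Ma; rewrite inE Ma cE /= => lt_a; apply/andP; split; first exact: lt_trans1.
  by rewrite /corank1 card_Dom ltn_eqF.
by move=> a; rewrite inE => /and3P[].
Qed.

Lemma thetaJ_congruence p rho : congruence (Hclass M (pid (E p))) rho ->
  congruence M (thetaJ M (J p) (tl p) rho).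
Proof.
move=> cr; have [lam fr] := frames1 p; have [DE _ DI _] := fr.
have cE := corank1_card DE.
rewrite /thetaJ belowJ_corank1; apply: (collapse_congruence invM fr) => //.
- by move=> a z; apply: ranklt_ideal.
- by move=> a Ma; rewrite cE inE Ma.
- move=> a; rewrite inE => /andP[_ lt_a].
  by rewrite /corank1 card_Dom ltn_eqF.
Qed.

Lemma thetaJ_mem p rho a b : (a, b) \in thetaJ M (J p) (tl p) rho ->
  [/\ a \in M, b \in M &
  [\/ a = b, a \in ranklt M (n - 1) /\ b \in ranklt M (n - 1) |
      corank1 p (Dom a) /\ corank1 p (Dom b)]].
Proof.
rewrite /thetaJ belowJ_corank1 => /(collapseP invM)[/= Ma Mb h].
by split=> //; case: h => [->|h|[Da <- _ _]]; [constructor 1|constructor 2|constructor 3].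
Qed.

Lemma thetaJ_refl p rho a : a \in M -> (a, a) \in thetaJ M (J p) (tl p) rho.
Proof. by move=> Ma; apply/(collapseP invM); split=> //; constructor 1. Qed.

Lemma thetaJ_ranklt p rho a b : a \in ranklt M (n - 1) -> b \in ranklt M (n - 1) ->
  (a, b) \in thetaJ M (J p) (tl p) rho.
Proof.
move=> la lb; have sM := subsetP (rankltM M (n - 1)).
rewrite /thetaJ belowJ_corank1; apply/(collapseP invM); rewrite !sM //.
by split=> //; constructor 2.
Qed.

(** Only transitivity is at stake for a union. Pairs of rank below n - 1 belong to both relations,
    and nontrivial pairs of the two classes never share an element, so two consecutive pairs can
    always be placed in one of the two relations. *)
Lemma thetaJU_congruence rho rho' :
  congruence (Hclass M (pid (E true))) rho ->
  congruence (Hclass M (pid (E false))) rho' ->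
  congruence M (thetaJ M (J true) (tl true) rho :|: thetaJ M (J false) (tl false) rho').
Proof.
move=> /thetaJ_congruence [s1 [r1 y1 t1] c1] /thetaJ_congruence[s2 [r2 y2 t2] c2].
have mix a b c p rho1 rho2 : (a, b) \in thetaJ M (J p) (tl p) rho1 ->
    (b, c) \in thetaJ M (J (~~ p)) (tl (~~ p)) rho2 ->
    (a, b) \in thetaJ M (J (~~ p)) (tl (~~ p)) rho2 \/
    (b, c) \in thetaJ M (J p) (tl p) rho1.
  move=> h k; case: (thetaJ_mem h) => Ma _ [eab|[la lb]|[Da Db]].
  - by left; rewrite -eab thetaJ_refl.
  - by left; apply: thetaJ_ranklt.
  case: (thetaJ_mem k) => _ Mc [ebc|[lb lc]|[Db' _]].
  - by right; rewrite ebc thetaJ_refl.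
  - by right; apply: thetaJ_ranklt.
  by move: Db Db'; rewrite /corank1 => /andP[_ /eqP->]; case: (p); rewrite andbF.
split; [by rewrite subUset s1|split|].
- by move=> a Ma; rewrite inE r1.
- by move=> a b /setUP[/y1|/y2] h; rewrite inE h ?orbT.
- move=> a b c /setUP[h|h] /setUP[k|k]; rewrite inE.
  + by rewrite (t1 _ _ _ h k).
  + by case: (mix _ _ _ true _ _ h k) => h'; [rewrite (t2 _ _ _ h' k) orbT|rewrite (t1 _ _ _ h h')].
  + by case: (mix _ _ _ false _ _ h k) => h'; [rewrite (t1 _ _ _ h' k)|rewrite (t2 _ _ _ h h') orbT].
  + by rewrite (t2 _ _ _ h k) orbT.
move=> a b z /setUP[h|h] Mz; rewrite !in_setU.
  by have [-> ->] := c1 _ _ _ h Mz.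
by have [-> ->] := c2 _ _ _ h Mz; rewrite !orbT.
Qed.

Section Classify.

Variable R : {set pperm n * pperm n}.
Hypothesis congR : congruence M R.

Local Notation Z := (zeroclass R).

Lemma swappable_two_classes : swappable M.
Proof.
move=> A x Ax nA; have [eA|ltA] := leqP n #|A|; last first.
  apply: (swappable_card invM) => //.
  exists (seg 1 #|A :\ x|), (tilde #|A :\ x|); apply: frames; left.
  have : 0 < #|A :\ x|.
    rewrite lt0n cards_eq0.
    by apply: contra nA; rewrite setD_eq0 => sA; rewrite eqEsubset sA sub1set.
  by move: ltA; rewrite (cardsD1 x A) Ax add1n => + ->; apply: lt_pred3.
have -> : A = setT by apply/eqP; rewrite eqEcard subsetT cardsT card_ord.
have lx := ltn_ord x.
(* Since n is at least 4, one of x + 2 and x - 2 is again a point, of the same parity. *)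
have [y nyx py] : exists2 y : 'I_n, y != x & odd (label y) = odd (label x).
  have [x2|x2] := ltnP x 2.
    have y2 : x + 2 < n by lia.
    by exists (Ordinal y2); [apply/eqP => /(congr1 val)/=; lia|rewrite /label /=; lia].
  have y2 : x - 2 < n by lia.
  by exists (Ordinal y2); [apply/eqP => /(congr1 val)/=; lia|rewrite /label /=; lia].
have [lam fr] := frames1 (odd (label x)).
have [|u [Mu Du Iu]] := frame_bij invM fr (corank1C x) (B := [set~ y]).
  by rewrite -py corank1C.
by exists y, u; rewrite in_setT !setTD Iu Du.
Qed.

(** Each class of rank n - 1 is either contained in Z or disjoint from it, and the class p0 of the
    given element is disjoint. The outcome depends on the fate of the other class. *)
Lemma classify_corank1 : ranklt M (n - 1) \subset Z ->
  (exists a, [/\ a \in M, #|Im a| = n - 1 & a \notin Z]) ->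
  exists rho : bool -> {set pperm n * pperm n},
    [/\ forall p, congruence (Hclass M (pid (E p))) (rho p)
     & (exists p, R = piJ M (J p) (tl p) (rho p)) \/
       R = thetaJ M (J true) (tl true) (rho true)
           :|: thetaJ M (J false) (tl false) (rho false)].
Proof.
move=> low [a0 [Ma0 ca0 nZ0]]; have sw := swappable_two_classes.
exists (fun p => restrict M R (E p)); split.
  by move=> p; apply: restrict_congruence.
have RM a b : (a, b) \in R -> a \in M.
  by case: congR => /subsetP sR _ _ /sR /setXP[].
have cls a : #|Im a| = n - 1 -> exists p, corank1 p (Dom a).
  by move=> ca; exists (odd (missing (Dom a))); rewrite /corank1 card_Dom ca !eqxx.
have [p0 D0] := cls _ ca0.
have full a : a \in M -> n <= #|Im a| -> Dom a = setT.
  move=> Ma le_n; apply/eqP.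
  by rewrite eqEcard subsetT cardsT card_ord card_Dom.
have nZp a : a \in Z -> corank1 p0 (Dom a) -> False.
  move=> Za Da; have [lam fr] := frames1 p0.
  by case/negP: nZ0; apply: (zeroclass_frame invM congR fr (zeroclassM congR Za) Ma0 Da D0).
have rankZ a : a \in Z -> #|Im a| < n.
  move=> Za; rewrite ltnNge; apply/negP => /(full _ (zeroclassM congR Za)) DT.
  case/negP: nZ0; have := zeroclass_sub invM congR (subsetT (Dom a0)).
  by rewrite -{1}DT !(zeroclass_Dom invM congR) ?(zeroclassM congR Za) //; apply.
(* Units are excluded through [rigid]: distinct related units disagree at some x of parity p0, and
   [zeroclass_moved] would then put [pid [set~ x]], which belongs to the class p0, into Z. *)
have pairs a b : (a, b) \in R -> a <> b -> a \notin Z -> #|Im a| = n - 1.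
  move=> r nab nZ; apply/eqP; rewrite eqn_leq; apply/andP; split; last first.
    rewrite leqNgt; apply: contra nZ => lt_a.
    by apply: (subsetP low); rewrite inE (RM _ _ r).
  apply: lt_pred; rewrite ltnNge; apply/negP => /(full _ (RM _ _ r)) DT.
  case: (congruence_zero_or_H invM congR sw r) => [[Za]|[eD _]].
    by rewrite Za in nZ.
  have Mb : b \in M by case: congR => _ [_ sym _] _; apply: RM (sym _ _ r).
  have [/forallP h|] := boolP [forall x, (odd (label x) == p0) ==> (a x == b x)].
    case: nab; apply: (rigid (p := p0)) => //; rewrite -?eD ?DT // ?(RM _ _ r) //.
    by move=> x px; have := h x; rewrite px eqxx => /eqP.
  rewrite negb_forall => /existsP[x]; rewrite negb_imply => /andP[/eqP px /eqP nx].
  have xT : x \in Dom a by rewrite DT.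
  have := zeroclass_moved invM congR sw r xT nx; rewrite DT setTD => Zx.
  by apply: (nZp _ Zx); rewrite Dom_pid -px corank1C.
(* If Z meets the other class it contains it, and Z is everything not above the class p0. Otherwise
   Z stops below rank n - 1 and R acts independently on the two classes. *)
have [Zq|nZq] := boolP [exists a in M, (a \in Z) && corank1 (~~ p0) (Dom a)].
  left; exists p0; have [lam fr] := frames1 p0.
  have eZ : notaboveJ M (J p0) = Z.
    rewrite notaboveJ_corank1; apply/setP => a; apply/idP/idP.
      rewrite inE => /and3P[Ma lt_a nD].
      have [lt1|ge1] := ltnP #|Im a| (n - 1).
        by apply: (subsetP low); rewrite inE Ma.
      have ea : #|Im a| = n - 1 by apply/eqP; rewrite eqn_leq ge1 lt_pred.
      have [q Dq] := cls _ ea.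
      have eq : q = ~~ p0.
        by case: (q) (p0) Dq nD => [] [] //= ->.
      case/exists_inP: Zq => b Mb /andP[Zb Db].
      have [lam' fr'] := frames1 (~~ p0); rewrite eq in Dq.
      exact: (zeroclass_frame invM congR fr' Mb Ma Db Dq).
    move=> Za; rewrite inE (zeroclassM congR Za) rankZ //=.
    by apply/negP => /(nZp _ Za).
  rewrite /piJ; apply: (congruence_collapse invM congR sw fr eZ).
  move=> a b r nab nZ; have ca := pairs _ _ r nab nZ; have [q Dq] := cls _ ca.
  have [<-//|nq] := eqVneq q p0.
  case/negP: nZ; rewrite -eZ notaboveJ_corank1 inE (RM _ _ r) ca /=.
  apply/andP; split; first by lia.
  apply: contra nq => Dp0; case/andP: Dp0 => _ /eqP <-.
  by case/andP: Dq => _ /eqP <-.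
right.
have eZ : ranklt M (n - 1) = Z.
  apply/eqP; rewrite eqEsubset low; apply/subsetP => a Za.
  have Ma := zeroclassM congR Za; rewrite inE Ma /=.
  have := lt_pred (rankZ _ Za); rewrite leq_eqVlt => /orP[/eqP ea|//].
  have [q Dq] := cls _ ea; have [eq|nq] := eqVneq q p0.
    by case: (nZp _ Za); rewrite -eq.
  case/negP: nZq; apply/exists_inP; exists a => //; rewrite Za.
  by case: (q) (p0) Dq nq => [] [].
have sub p : thetaJ M (J p) (tl p) (restrict M R (E p)) \subset R.
  have [lam fr] := frames1 p; apply/subsetP => -[a b].
  rewrite /thetaJ belowJ_corank1 eZ => /(collapseP invM)[/= Ma Mb].
  case=> [->|[Za Zb]|[Da eD eI]].
  - by case: congR => _ [rfl _ _] _; apply: rfl.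
  - exact: (zeroclass_rel congR).
  by rewrite (restrict_tl invM congR fr).
apply/eqP; rewrite eqEsubset subUset !sub !andbT; apply/subsetP => -[a b] r.
have inU p : (a, b) \in thetaJ M (J p) (tl p) (restrict M R (E p)) ->
  (a, b) \in thetaJ M (J true) (tl true) (restrict M R (E true))
          :|: thetaJ M (J false) (tl false) (restrict M R (E false)).
  by rewrite in_setU; case: p => ->; rewrite ?orbT.
have [Ma Mb] : a \in M /\ b \in M.
  by case: congR => /subsetP sR _ _; have /setXP := sR _ r.
have [eab|/eqP nab] := eqVneq a b.
  by apply: (inU true); rewrite -eab; apply: thetaJ_refl.
case: (congruence_zero_or_H invM congR sw r) => [[Za Zb]|[eD eI]].
  by apply: (inU true); apply: thetaJ_ranklt; rewrite eZ.
have [Za|nZ] := boolP (a \in Z).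
  apply: (inU true); apply: thetaJ_ranklt; rewrite eZ //.
  by rewrite -(zeroclass_Dom invM congR) // -eD (zeroclass_Dom invM congR).
have [q Dq] := cls _ (pairs _ _ r nab nZ); apply: (inU q).
have [lam fr] := frames1 q.
rewrite /thetaJ; apply/(collapseP invM); split=> //; constructor 3; split=> //=.
by rewrite (restrict_tl invM congR fr).
Qed.

End Classify.

Lemma congruences_two_classes R : congruence M R <->
  [\/ R = setX M M,
      exists k rho, [/\ 1 <= k <= n - 2 \/ k = n,
        congruence (Hclass M (pid (seg 1 k))) rho & R = piJ M (rankJ M k) (tilde k) rho]
    | exists rho1 rho2, [/\ congruence (Hclass M (pid (E true))) rho1,
        congruence (Hclass M (pid (E false))) rho2
      & [\/ R = piJ M (oddJ M) (tl true) rho1, R = piJ M (evenJ M) (tl false) rho2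
          | R = thetaJ M (oddJ M) (tl true) rho1 :|: thetaJ M (evenJ M) (tl false) rho2]]].
Proof.
rewrite oddJ_classof evenJ_classof.
split=> [cR|[->|[k [rho [hk cr ->]]]|[rho1 [rho2 [c1 c2]]]]]; last 3 first.
- exact: universal_congruence.
- exact: (piJ_rank_congruence invM (frames hk)).
- case=> ->; [exact: piJ_corank1_congruence|exact: piJ_corank1_congruence|].
  exact: thetaJU_congruence.
have sw := swappable_two_classes.
have [ZT|nZT] := boolP (pid setT \in zeroclass R).
  by constructor 1; apply: zeroclass_unit.
have [k [hk sk ak]] := zeroclass_level invM cR nZT.
have [ek|nk] := eqVneq k (n - 1); last first.
  have hk' : 1 <= k <= n - 2 \/ k = n by move: hk nk; lia.
  have [rho cr eR] := classify_rank invM cR sw (frames hk') hk sk ak.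
  by constructor 2; exists k, rho.
rewrite ek in sk ak; have [rho [cr eR]] := classify_corank1 cR sk ak.
constructor 3; exists (rho true), (rho false); split=> //.
case: eR => [[[] eR]|eR]; [by constructor 1|by constructor 2|by constructor 3].
Qed.

End TwoClassesOfCorank1.

(** * Orientation and the cyclic order *)

Section CyclicDescents.

Variables (T : eqType) (r : rel T).
Hypothesis r_irr : irreflexive r.
Hypothesis r_trans : transitive r.
Hypothesis r_total : forall x y, x != y -> r x y || r y x.
Implicit Type s t : seq T.

Definition cyclic3 x y z := [|| r x y && r y z, r y z && r z x | r z x && r x y].

(** A condition invariant under rotation and equivalent to having at most one cyclic descent. The
    order r is abstract so that reversing it treats the orientation-reversing maps. *)
Definition cyclic_triples s :=
  forall x y z, subseq [:: x; y; z] s -> cyclic3 x y z.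

Definition cyclic_descents s :=
  count (fun p => r p.2 p.1) (zip s (rot 1 s)).

Let r_asym x y : r x y -> r y x = false.
Proof. by move=> xy; apply/negP => /(r_trans xy); rewrite r_irr. Qed.

Lemma cyclic3C x y z : cyclic3 x y z = cyclic3 y z x.
Proof. by rewrite /cyclic3; case: (r x y) (r y z) (r z x) => [] [] []. Qed.

Lemma subseq_rcons_cases t s (x a : T) :
  subseq (rcons t x) (rcons s a) -> subseq (rcons t x) s \/ x = a /\ subseq t s.
Proof.
rewrite -subseq_rev !rev_rcons /=; case: eqP => [->|_] h.
  by right; rewrite -subseq_rev.
by left; rewrite -subseq_rev rev_rcons.
Qed.

Lemma cyclic_triples_rot1 s : cyclic_triples (rot 1 s) <-> cyclic_triples s.
Proof.
case: s => [|a s]; rewrite ?rot0 // rot1_cons; split=> h x y z.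
  rewrite /=; case: eqP => [->|_] sub.
    rewrite cyclic3C; apply: h; rewrite -cats1.
    exact: (cat_subseq sub (subseq_refl [:: a])).
  apply: h; apply: subseq_trans sub _; exact: subseq_rcons.
rewrite -[[:: x; y; z]]/(rcons [:: x; y] z).
case/subseq_rcons_cases => [sub|[-> sub]].
  by apply: h; apply: subseq_trans sub (subseq_cons _ _).
by rewrite -cyclic3C; apply: h; rewrite /= eqxx.
Qed.

Lemma cyclic_descents_rot1 s : cyclic_descents (rot 1 s) = cyclic_descents s.
Proof.
case: s => [|x [|y t]] //; rewrite /cyclic_descents !rot1_cons.
rewrite zip_rcons ?size_rcons //.
by rewrite -cats1 count_cat /= addn0 addnC.
Qed.

Lemma rot_ind (P : seq T -> Prop) s i :
  (forall t, P (rot 1 t) <-> P t) -> P (rot i s) <-> P s.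
Proof.
move=> h; elim: i => [|i IH]; first by rewrite rot0.
have [lt_i|ge_i] := ltnP i (size s); last by rewrite rot_oversize // ltnW.
by rewrite rotS // h.
Qed.

Lemma ex_min_seq x0 s :
  exists2 m, m \in x0 :: s & forall y, y \in x0 :: s -> y != m -> r m y.
Proof.
elim: s x0 => [|x1 s IH] x0.
  by exists x0; rewrite ?inE // => y; rewrite inE => ->.
have [m m_in minm] := IH x1.
have [->|nx0] := eqVneq x0 m.
  exists m; first by rewrite inE eqxx.
  by move=> y; rewrite inE => /orP[/eqP->|/minm//]; rewrite eqxx.
have [xm|nxm] := boolP (r x0 m).
  exists x0; first by rewrite inE eqxx.
  move=> y; rewrite inE => /orP[->//|/minm h] _.
  by have [->//|/h] := eqVneq y m; apply: r_trans.
exists m; first by rewrite inE m_in orbT.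
move=> y; rewrite inE => /orP[/eqP->|/minm//] _.
by move: (r_total nx0); rewrite (negPf nxm).
Qed.

Let desc x t := count (fun p => r p.2 p.1) (zip (x :: t) t).

Lemma count_zip_rcons x t m :
  count (fun p => r p.2 p.1) (zip (x :: t) (rcons t m)) = desc x t + r m (last x t).
Proof.
elim: t x => [|y t IH] x /=; first by rewrite /desc /= addn0 add0n.
by rewrite IH /desc /= addnA.
Qed.

Lemma desc_path x t : uniq (x :: t) -> (desc x t == 0) = path r x t.
Proof.
elim: t x => [|y t IH] x // /andP[nx u] /=.
rewrite /desc /= addn_eq0 -/(desc y t) IH //; congr (_ && _).
have nxy : x != y by apply: contraNneq nx => ->; rewrite inE eqxx.
have := r_total nxy; case: (boolP (r x y)) => [/r_asym->//|_ /= ->//].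
Qed.

Lemma subseq2_sorted t : (forall x y, subseq [:: x; y] t -> r x y) -> sorted r t.
Proof.
elim: t => [|x t IH] // h; have st : sorted r t.
  by apply: IH => y z s; apply: h; apply: subseq_trans s (subseq_cons _ _).
case: t h st {IH} => // y t h /= ->; rewrite andbT; apply: h.
by rewrite /= !eqxx sub0seq.
Qed.

(** With the minimum in front, both conditions say that the list is sorted: the pair that closes a
    list of at least two entries is always a descent, so no other is allowed; and a triple m, x, y
    in cyclic order means that x precedes y. *)
Lemma cyclic_descents_min m t : uniq (m :: t) -> (forall y, y \in t -> r m y) ->
  cyclic_descents (m :: t) <= 1 <-> cyclic_triples (m :: t).
Proof.
move=> u minm.
have -> : (cyclic_descents (m :: t) <= 1) = path r m t.
  rewrite /cyclic_descents rot1_cons count_zip_rcons -desc_path //.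
  case: t u minm => [|y t] u minm; first by rewrite /desc /= r_irr.
  have -> : r m (last m (y :: t)) by apply: minm; rewrite /= mem_last.
  by rewrite addn1 ltnS leqn0.
split=> [p x y z s|h].
  have := subseq_sorted r_trans s p; rewrite /= andbT => /andP[xy yz].
  by rewrite /cyclic3 xy yz.
suff : sorted r t by case: t {u h} minm => //= y t minm ->; rewrite minm ?inE ?eqxx.
apply: subseq2_sorted => x y s.
have [mx my] : r m x /\ r m y.
  by split; apply: minm; apply: (mem_subseq s); rewrite !inE eqxx ?orbT.
have := h m x y; rewrite /cyclic3 /= eqxx mx (r_asym my) /= !andbF !orbF.
by apply.
Qed.

(** Both sides are invariant under rotation, so the minimum may be brought to the front. *)
Lemma cyclic_descentsP s : uniq s -> cyclic_descents s <= 1 <-> cyclic_triples s.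
Proof.
case: s => [|x0 s] u; first by split=> // _ x y z.
have [m m_in minm] := ex_min_seq x0 s.
have [i t et] := rot_to m_in.
have ut : uniq (m :: t) by rewrite -et rot_uniq.
rewrite -(@rot_ind (fun s => cyclic_descents s <= 1) _ i); last first.
  by move=> v; rewrite cyclic_descents_rot1.
rewrite -(@rot_ind cyclic_triples _ i) ?et; last exact: cyclic_triples_rot1.
apply: cyclic_descents_min => // y yt; apply: minm.
  by rewrite -(mem_rot i) et inE yt orbT.
by apply: contraTneq yt => ->; case/andP: ut.
Qed.

End CyclicDescents.

Lemma subseq_pmap (S T : eqType) (f : S -> option T) (t : seq T) (s : seq S) :
  subseq t (pmap f s) <-> exists2 u, subseq u s & map f u = map Some t.
Proof.
split.
  elim: s t => [|x s IH] [|y t] //=; try by exists [::]; rewrite ?sub0seq.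
  case fx: (f x) => [z|] /=; last first.
    by case/IH => u su eu; exists u => //; apply: subseq_trans su (subseq_cons _ _).
  case: eqP => [->|_] /IH[u su eu].
    by exists (x :: u); rewrite /= ?eqxx // fx eu.
  by exists u => //; apply: subseq_trans su (subseq_cons _ _).
case=> u; elim: s u t => [|x s IH] [|y u] [|z t] //=; rewrite ?sub0seq //.
case: eqP => [->|_] su; last first.
  move=> eu; have h := IH (y :: u) (z :: t) su eu.
  by case: (f x) => //= w; apply: subseq_trans h (subseq_cons _ _).
by case=> -> eu /=; rewrite eqxx; apply: IH eu.
Qed.

Lemma pmap_inj_uniq (S T : eqType) (f : S -> option T) (s : seq S) :
  (forall x y z, f x = Some z -> f y = Some z -> x = y) ->
  uniq s -> uniq (pmap f s).
Proof.
move=> inj; elim: s => [|x s IH] //= /andP[nx u].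
case fx: (f x) => [z|] /=; last exact: IH.
rewrite IH // andbT; apply: contra nx; rewrite mem_pmap => /mapP[y ys fy].
by rewrite (inj x y z).
Qed.

Definition cyc (x y z : nat) : bool := [|| x < y < z, y < z < x | z < x < y].

Section Orientation.

Variable n : nat.
Implicit Types (a b : pperm n) (x y z : 'I_n).

Definition cyclic_on a := forall x y z x' y' z',
  a x = Some x' -> a y = Some y' -> a z = Some z' -> cyc x y z -> cyc x' y' z'.

Definition anticyclic_on a := forall x y z x' y' z',
  a x = Some x' -> a y = Some y' -> a z = Some z' -> cyc x y z -> cyc z' y' x'.

Lemma subseq3_enum x y z : subseq [:: x; y; z] (enum 'I_n) <-> x < y < z.
Proof.
pose r := fun x y : 'I_n => x < y.
have tr : transitive r by move=> u v w; apply: ltn_trans.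
have se : sorted r (enum 'I_n).
  have := iota_ltn_sorted 0 n; rewrite -val_enum_ord sorted_map.
  by congr (sorted _ _).
split=> [s|h].
  by have := subseq_sorted tr s se; rewrite /= andbT.
have -> : [:: x; y; z] = [seq t <- enum 'I_n | t \in [:: x; y; z]].
  apply: (irr_sorted_eq tr) => //.
  - by move=> t; apply: ltnn.
  - by rewrite /= andbT.
  - exact: sorted_filter.
  by move=> t; rewrite mem_filter mem_enum andbT.
exact: filter_subseq.
Qed.

Lemma cyclic_triples_images (r : rel 'I_n) a :
  cyclic_triples r (images a) <->
  forall x y z x' y' z', a x = Some x' -> a y = Some y' -> a z = Some z' ->
    x < y < z -> cyclic3 r x' y' z'.
Proof.
split=> [h x y z x' y' z' ax ay az lt|h x' y' z'].
  apply: h; apply/subseq_pmap; exists [:: x; y; z]; first exact/subseq3_enum.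
  by rewrite /= ax ay az.
case/subseq_pmap => [[|x [|y [|z [|]]]]] //= s [ax ay az].
exact: h _ _ _ _ _ _ ax ay az ((subseq3_enum _ _ _).1 s).
Qed.

Lemma orientation_preservingP a :
  orientation_preserving a <-> cyclic_on a.
Proof.
pose r := fun x y : 'I_n => x < y.
have uI : uniq (images a).
  by apply: pmap_inj_uniq; [apply: pperm_inj|apply: enum_uniq].
have -> : orientation_preserving a <-> cyclic_triples r (images a).
  apply: iff_trans (cyclic_descentsP _ _ _ uI) => //.
  - by move=> x; apply: ltnn.
  - by move=> x y z; apply: ltn_trans.
  - by move=> x y; rewrite neq_ltn.
rewrite cyclic_triples_images; split=> h x y z x' y' z' ax ay az.
  (* A triple in cyclic order has an increasing rotation, so h is supplied for all three
     rotations. *)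
  have := h x y z _ _ _ ax ay az; have := h y z x _ _ _ ay az ax.
  have := h z x y _ _ _ az ax ay.
  rewrite /cyc /cyclic3 /r; lia.
move=> lt; apply: (h _ _ _ _ _ _ ax ay az); by rewrite /cyc lt.
Qed.

(** Same argument with r the reversed order, whose cyclic descents are the cyclic ascents of the
    usual one. *)
Lemma orientation_reversingP a :
  orientation_reversing a <-> anticyclic_on a.
Proof.
pose r := fun x y : 'I_n => y < x.
have uI : uniq (images a).
  by apply: pmap_inj_uniq; [apply: pperm_inj|apply: enum_uniq].
have -> : orientation_reversing a <-> cyclic_triples r (images a).
  apply: iff_trans (cyclic_descentsP _ _ _ uI) => //.
  - by move=> x; apply: ltnn.
  - by move=> x y z lt1 lt2; apply: ltn_trans lt2 lt1.
  - by move=> x y; rewrite neq_ltn orbC.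
rewrite cyclic_triples_images; split=> h x y z x' y' z' ax ay az.
  have := h x y z _ _ _ ax ay az; have := h y z x _ _ _ ay az ax.
  have := h z x y _ _ _ az ax ay.
  rewrite /cyc /cyclic3 /r; lia.
move=> lt; have := h _ _ _ _ _ _ ax ay az; rewrite /cyc lt => /(_ isT).
rewrite /cyclic3 /r; lia.
Qed.

Lemma cyclic_mul a b : cyclic_on a -> cyclic_on b -> cyclic_on (a * b).
Proof.
move=> ca cb x y z x' y' z' /pmulP[x1 a1 b1] /pmulP[y1 a2 b2] /pmulP[z1 a3 b3] c.
exact: cb b1 b2 b3 (ca _ _ _ _ _ _ a1 a2 a3 c).
Qed.

Lemma cyclic_antimul a b : cyclic_on a -> anticyclic_on b -> anticyclic_on (a * b).
Proof.
move=> ca cb x y z x' y' z' /pmulP[x1 a1 b1] /pmulP[y1 a2 b2] /pmulP[z1 a3 b3] c.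
exact: cb b1 b2 b3 (ca _ _ _ _ _ _ a1 a2 a3 c).
Qed.

Lemma anticyclic_mul a b : anticyclic_on a -> cyclic_on b -> anticyclic_on (a * b).
Proof.
move=> ca cb x y z x' y' z' /pmulP[x1 a1 b1] /pmulP[y1 a2 b2] /pmulP[z1 a3 b3] c.
exact: cb b3 b2 b1 (ca _ _ _ _ _ _ a1 a2 a3 c).
Qed.

Lemma anticyclic_antimul a b : anticyclic_on a -> anticyclic_on b -> cyclic_on (a * b).
Proof.
move=> ca cb x y z x' y' z' /pmulP[x1 a1 b1] /pmulP[y1 a2 b2] /pmulP[z1 a3 b3] c.
exact: cb b3 b2 b1 (ca _ _ _ _ _ _ a1 a2 a3 c).
Qed.

Let pperm_neq a x y x' y' : a x = Some x' -> a y = Some y' -> x' != y' :> nat ->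
  x != y :> nat.
Proof.
by move=> ax ay; apply: contra => /eqP /ord_inj e; move: ay; rewrite -e ax => -[->].
Qed.

(** Three distinct points are in cyclic order in exactly one of the two senses; if the preimages had
    the wrong sense, a would carry it to the images. *)
Lemma cyclic_inv a : cyclic_on a -> cyclic_on a^-1.
Proof.
move=> ca x y z x' y' z' /pinvP ax /pinvP ay /pinvP az c.
have := ca _ _ _ _ _ _ az ay ax; have := pperm_neq ax ay; have := pperm_neq ay az.
by have := pperm_neq ax az; move: c; rewrite /cyc; lia.
Qed.

Lemma anticyclic_inv a : anticyclic_on a -> anticyclic_on a^-1.
Proof.
move=> ca x y z x' y' z' /pinvP ax /pinvP ay /pinvP az c.
have := ca _ _ _ _ _ _ ax ay az; have := pperm_neq ax ay; have := pperm_neq ay az.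
by have := pperm_neq ax az; move: c; rewrite /cyc; lia.
Qed.

Lemma increasing_cyclic a :
  (forall x y x' y', a x = Some x' -> a y = Some y' -> x < y -> x' < y') ->
  cyclic_on a.
Proof.
move=> inc x y z x' y' z' ax ay az.
have := inc _ _ _ _ ax ay; have := inc _ _ _ _ ay az; have := inc _ _ _ _ az ax.
by rewrite /cyc; lia.
Qed.

Lemma cyclic_pid A : @cyclic_on (pid A).
Proof. by apply: increasing_cyclic => x y x' y' /pidP[_ ->] /pidP[_ ->]. Qed.

End Orientation.

(** * Order-preserving bijections and signs *)

Section OrderBijections.

Variable n : nat.
Implicit Types (a b c : pperm n) (x y z : 'I_n) (A B C : {set 'I_n}).

Definition increasing a :=
  forall x y x' y', a x = Some x' -> a y = Some y' -> x < y -> x' < y'.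

Lemma increasing_mul a b : increasing a -> increasing b -> increasing (a * b).
Proof.
move=> ia ib x y x' y' /pmulP[x1 a1 b1] /pmulP[y1 a2 b2] lt.
exact: ib _ _ _ _ b1 b2 (ia _ _ _ _ a1 a2 lt).
Qed.

(** Induction on the point x, all smaller points of the domain being fixed. A value below x would be
    a fixed point, against injectivity; with a value above x, the preimage of x would be a smaller
    point, hence fixed, or a larger one, against monotonicity. *)
Lemma increasing_pid a : Im a = Dom a -> increasing a -> a = pid (Dom a).
Proof.
move=> eI inc; apply: ppermPS => x y; rewrite pidP.
have fixpt : forall m x, x < m -> forall y, a x = Some y -> y = x.
  elim=> [//|m IH] {}x lt_m {}y axy; apply/ord_inj.
  have [lt|gt|//] := ltngtP (y : nat) x.
    have /DomP[w ayw] : y \in Dom a by rewrite -eI (mem_Im axy).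
    have ew := IH y (leq_trans lt lt_m) _ ayw; rewrite ew in ayw.
    by rewrite {1}(pperm_inj ayw axy).
  have /ImP[w awx] : x \in Im a by rewrite eI (mem_Dom axy).
  have [lt|gt'|e] := ltngtP (w : nat) x.
  - by have e := IH w (leq_trans lt lt_m) _ awx; move: lt; rewrite e ltnn.
  - by have := inc _ _ _ _ axy awx gt'; rewrite ltnNge ltnW.
  by move: awx; rewrite (ord_inj e) axy => -[->].
split=> [axy|[/DomP[z axz] ->]]; last by rewrite axz (fixpt _ _ (leqnn _) _ axz).
by split; [apply: mem_Dom axy|apply: fixpt axy].
Qed.

Let ltr := fun x y : 'I_n => x < y.
Let ltr_trans : transitive ltr. Proof. by move=> u v w; apply: ltn_trans. Qed.

Let sorted_enum A : sorted ltr (enum A).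
Proof.
have /(subseq_sorted ltr_trans) : subseq (enum A) (enum 'I_n).
  by rewrite {1}/(enum A) -[Finite.enum _]enumT; apply: filter_subseq.
apply; have := iota_ltn_sorted 0 n; rewrite -val_enum_ord sorted_map.
by congr (sorted _ _).
Qed.

Lemma order_bijP A B x y : #|A| = #|B| ->
  order_bij A B x = Some y <->
    [/\ x \in A, y \in B & index y (enum B) = index x (enum A)].
Proof.
move=> cAB; rewrite ffunE; case Ax: (x \in A); last by split=> [|[]].
have lt : index x (enum A) < size (enum B).
  by rewrite -cardE -cAB cardE index_mem mem_enum.
split=> [o|[_ By <-]].
  have e := onth_nth y _ _ _ o.
  have By : y \in enum B by rewrite -[y in y \in _]e mem_nth.
  by split; [|rewrite -mem_enum|rewrite -[y in LHS]e index_uniq ?enum_uniq].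
by rewrite onthE (nth_map y) ?index_mem ?mem_enum // nth_index ?mem_enum.
Qed.

Lemma order_bij_inv A B : #|A| = #|B| -> (order_bij A B)^-1 = order_bij B A.
Proof.
move=> cAB; apply: ppermPS => x y; rewrite pinvP !order_bijP //.
by split=> [] [].
Qed.

Lemma Dom_order_bij A B : #|A| = #|B| -> Dom (order_bij A B) = A.
Proof.
move=> cAB; apply/setP => x; apply/DomP/idP => [[y /order_bijP[]]//|Ax].
have lt : index x (enum A) < size (enum B).
  by rewrite -cardE -cAB cardE index_mem mem_enum.
exists (nth x (enum B) (index x (enum A))); apply/order_bijP => //.
by split; rewrite ?index_uniq ?enum_uniq // -mem_enum mem_nth.
Qed.

Lemma Im_order_bij A B : #|A| = #|B| -> Im (order_bij A B) = B.
Proof. by move=> cAB; rewrite -Dom_pinv order_bij_inv // Dom_order_bij. Qed.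

Lemma order_bij_increasing A B : #|A| = #|B| -> increasing (order_bij A B).
Proof.
move=> cAB x y x' y' /order_bijP[]// Ax Bx' ex /order_bijP[]// Ay By' ey lt.
apply: (sorted_ltn_index ltr_trans (sorted_enum B)); rewrite ?mem_enum //.
rewrite ex ey ltnNge leq_eqVlt negb_or; apply/andP; split.
  apply: contraTneq lt => e; rewrite -leqNgt.
  by rewrite -(nth_index x (_ : x \in enum A)) ?mem_enum // -e nth_index ?mem_enum.
apply: contraTN lt => lt.
have : ltr y x by apply: (sorted_ltn_index ltr_trans (sorted_enum A)); rewrite ?mem_enum.
by rewrite /ltr -leqNgt => /ltnW.
Qed.

(** Composed with the order bijection back to its domain, a becomes an increasing permutation of Dom
    a, hence the identity. *)
Lemma increasing_order_bij a : increasing a -> a = order_bij (Dom a) (Im a).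
Proof.
move=> inc; have cc := card_Dom a; have cc' := esym cc.
have e : a * order_bij (Im a) (Dom a) = pid (Dom a).
  have eD : Dom (a * order_bij (Im a) (Dom a)) = Dom a.
    by rewrite Dom_mul ?Dom_order_bij.
  rewrite -[in RHS]eD; apply: increasing_pid.
    by rewrite eD Im_mul ?Im_order_bij ?Dom_order_bij.
  by apply: increasing_mul => //; apply: order_bij_increasing.
rewrite -[LHS](mul_pid_id (subxx (Im a))) -{1}(Dom_order_bij cc') -pmulV mulgA e.
by rewrite order_bij_inv // pid_mul_id ?Dom_order_bij.
Qed.

End OrderBijections.

(** * Signs of completions *)

Section Sign.

Variable n : nat.
Implicit Types (a b c : pperm n) (x y z : 'I_n) (A B C : {set 'I_n}) (s : 'S_n).

(* [a] has a completion of sign [e]; for rank at most n - 2 both signs occur. *)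
Definition signed (e : bool) a :=
  exists2 s : 'S_n, odd_perm s = e & forall x y, a x = Some y -> s x = y.

Lemma alternatingP a : alternating a <-> signed false a.
Proof.
split=> [/existsP[s /andP[/negbTE os /forall_inP h]]|[s os h]].
  by exists s => // x y axy; apply/eqP; have := h x (mem_Dom axy); rewrite axy eq_sym.
apply/existsP; exists s; rewrite os /=; apply/forall_inP => x /DomP[y axy].
by rewrite axy (h _ _ axy).
Qed.

Lemma signed_mul e e' a b : signed e a -> signed e' b -> signed (e (+) e') (a * b).
Proof.
move=> [s os hs] [t ot ht]; exists (s * t); first by rewrite odd_permM os ot.
by move=> x y /pmulP[z /hs <- /ht <-]; rewrite permM.
Qed.

Lemma signed_inv e a : signed e a -> signed e a^-1.
Proof.
move=> [s os hs]; exists s^-1; first by rewrite odd_permV.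
by move=> x y /pinvP/hs <-; rewrite permK.
Qed.

Lemma signed_pid A : signed false (pid A).
Proof. by exists 1; [rewrite odd_perm1|move=> x y /pidP[_ ->]; rewrite perm1]. Qed.

(** Two permutations that agree on all points but at most one are equal. *)
Lemma signed_uniq e e' a : n - 1 <= #|Dom a| -> signed e a -> signed e' a -> e = e'.
Proof.
move=> cD [s <- hs] [t <- ht]; congr odd_perm.
have st x : x \in Dom a -> s x = t x by case/DomP=> y axy; rewrite (hs _ _ axy) (ht _ _ axy).
apply/permP => d; have [/st//|nd] := boolP (d \in Dom a).
have eD x : x != d -> s x = t x.
  move=> nx; apply: st; apply: contraT => nDx.
  have sub : Dom a \subset ~: [set x; d].
    by apply/subsetP => y Dy; rewrite !inE negb_or;
      apply/andP; split; [apply: contraNneq nDx => <-|apply: contraNneq nd => <-].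
  have := leq_trans cD (subset_leq_card sub); rewrite cardsCs setCK cards2 nx card_ord.
  have : x != d :> nat by [].
  by move: (ltn_ord x) (ltn_ord d); lia.
have [ed|nd'] := eqVneq ((t^-1) (s d)) d; first by rewrite -{2}ed permKV.
by have := eD _ nd'; rewrite permKV => /perm_inj ed; rewrite ed eqxx in nd'.
Qed.

Lemma ex_perm a : exists s : 'S_n, forall x y, a x = Some y -> s x = y.
Proof.
have cC : #|~: Dom a| = #|~: Im a|.
  by rewrite cardsCs [RHS]cardsCs !setCK card_Dom.
pose b := order_bij (~: Dom a) (~: Im a).
pose f x := if a x is Some y then y else odflt x (b x).
have injf : injective f.
  have fb x : a x = None -> exists2 y, b x = Some y & y \notin Im a.
    move=> ax; have /DomP[y bxy] : x \in Dom b.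
      by rewrite Dom_order_bij // !inE ax.
    by exists y => //; have := mem_Im bxy; rewrite Im_order_bij // inE.
  move=> x y; rewrite /f.
  case ax: (a x) => [x'|]; case ay: (a y) => [y'|].
  - by move=> e; rewrite e in ax; apply: pperm_inj ax ay.
  - by have [z -> /= nz] := fb _ ay; move=> e; rewrite -e (mem_Im ax) in nz.
  - by have [z -> /= nz] := fb _ ax; move=> e; rewrite e (mem_Im ay) in nz.
  have [z bx _] := fb _ ax; have [w by_ _] := fb _ ay; rewrite bx by_ /= => e.
  by rewrite e in bx; apply: pperm_inj bx by_.
by exists (perm injf) => x y axy; rewrite permE /f axy.
Qed.

(** Two points lie outside the domain; transposing them first changes the sign of a completion
    without changing its restriction to the domain. *)
Lemma signed_small e a : 2 <= n -> #|Dom a| <= n - 2 -> signed e a.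
Proof.
move=> n2 cD; have [s hs] := ex_perm a.
have [<-|ne] := eqVneq (odd_perm s) e; first by exists s.
have /card_gt1P[u [v [Du Dv nuv]]] : 1 < #|~: Dom a|.
  by rewrite cardsCs setCK card_ord; lia.
exists (tperm u v * s).
  by rewrite odd_permM odd_tperm nuv /=; case: (odd_perm s) e ne => [] [].
move=> x y axy; rewrite permM tpermD; first exact: hs.
  by move: Du; apply: contraTneq => ->; rewrite inE (mem_Dom axy).
by move: Dv; apply: contraTneq => ->; rewrite inE (mem_Dom axy).
Qed.

End Sign.

Lemma cyclic_order_bij n (A B : {set 'I_n}) : #|A| = #|B| -> cyclic_on (order_bij A B).
Proof. by move=> cAB; apply/increasing_cyclic/order_bij_increasing. Qed.

Section PermRestriction.

Variable n : nat.
Implicit Types (s : 'S_n) (A : {set 'I_n}).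

Definition restr_perm_fun s A := [ffun x => if x \in A then Some (s x) else None].

Lemma restr_perm_pinj s A : pinjective (restr_perm_fun s A).
Proof.
apply/pinjectiveP=> x y z; rewrite !ffunE.
by do 2![case: ifP => // _] => - [<-] [/perm_inj].
Qed.

Definition pperm_of s A : pperm n := PPerm (restr_perm_pinj s A).

Lemma pperm_ofP s A x y : pperm_of s A x = Some y <-> x \in A /\ s x = y.
Proof. by rewrite ffunE; case: ifP => Ax; split=> [|[]] // => [[]|_ ->]. Qed.

End PermRestriction.

Section Signs.

Variable n : nat.
Implicit Types (i j x y : 'I_n).

(** The completion is [lift_perm i j 1], which sends i to j and is increasing elsewhere. Ordinals
    start at 0 and labels at 1, but the parity of a sum of two is the same. *)
Lemma signed_order_bij_C1 i j :
  signed (odd i (+) odd j) (order_bij [set~ i] [set~ j]).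
Proof.
case: n i j => [|m] i j; first by case: i.
pose f := pperm_of (lift_perm i j 1) [set~ i].
have liftE (x y : 'I_m.+1) : f x = Some y -> exists2 u, x = lift i u & y = lift j u.
  case/pperm_ofP; rewrite !inE => nx <-; case: (unliftP i x) nx => [u ->|->].
    by exists u; rewrite ?lift_perm_lift ?perm1.
  by rewrite eqxx.
have inc : increasing f.
  move=> x y x' y' /liftE[u -> ->] /liftE[v -> ->] /=.
  by rewrite /bump; lia.
have eD : Dom f = [set~ i].
  by apply/setP => x; apply/DomP/idP => [[y /pperm_ofP[]]//|nx];
    exists (lift_perm i j 1 x); apply/pperm_ofP.
have eI : Im f = [set~ j].
  apply/eqP; rewrite eqEcard -card_Dom eD !cardC1n leqnn andbT.
  apply/subsetP => y /ImP[x /liftE[u _ ->]].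
  by rewrite !inE eq_sym neq_lift.
rewrite -eD -eI -increasing_order_bij //; exists (lift_perm i j 1).
  by rewrite odd_lift_perm odd_perm1 addbF.
by move=> x y /pperm_ofP[].
Qed.

Lemma gmapP x y : gmap x = Some y <->
  (x.+2 < n /\ y = x.+1 :> nat) \/ (x.+2 = n /\ y = 0 :> nat).
Proof.
rewrite ffunE /label; case: ifP => h1.
  by rewrite pointP /label; lia.
case: ifP => h2; first by rewrite pointP /label; lia.
by split=> //; lia.
Qed.

Lemma hmapP x y : hmap x = Some y <-> x + y + 2 = n.
Proof.
rewrite ffunE /label; case: ifP => h1; first by rewrite pointP /label; lia.
by split=> //; lia.
Qed.

Lemma gmap_cyclic : cyclic_on (@gmap n).
Proof.
by move=> x y z x' y' z' /gmapP + /gmapP + /gmapP; rewrite /cyc; lia.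
Qed.

Lemma hmap_anticyclic : anticyclic_on (@hmap n).
Proof.
by move=> x y z x' y' z' /hmapP + /hmapP + /hmapP; rewrite /cyc; lia.
Qed.

Lemma hmap_inv : (@hmap n)^-1 = hmap.
Proof. by apply: ppermPS => x y; rewrite pinvP !hmapP (addnC x). Qed.

End Signs.

Lemma seg_n1 m : seg 1 (m.+1 - 1) = [set~ ord_max] :> {set 'I_m.+1}.
Proof.
apply/setP => x; rewrite !inE -val_eqE /label /=.
by have := ltn_ord x; lia.
Qed.

Lemma seg_2n m : seg 2 m.+1 = [set~ ord0] :> {set 'I_m.+1}.
Proof.
apply/setP => x; rewrite !inE -val_eqE /label /=.
by have := ltn_ord x; lia.
Qed.

(** Fixing the last point completes the rotation to a cycle of length n - 1, of sign n - 2. *)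
Lemma signed_gmap n : 2 <= n -> signed (odd n) (@gmap n).
Proof.
case: n => [|[|m]] // _; exists (lift_perm ord_max ord_max (lift_perm ord_max ord0 1)).
  by rewrite !odd_lift_perm odd_perm1 /= negbK; case: odd.
move=> x y /gmapP h; apply/ord_inj.
case: (unliftP ord_max x) h => [u ->|->]; rewrite ?lift_perm_lift ?lift_perm_id /=.
  case: (unliftP ord_max u) => [v ->|->]; rewrite ?lift_perm_lift ?lift_perm_id ?perm1 /=.
    by rewrite /bump /=; have := ltn_ord v; lia.
  by rewrite /bump; lia.
by lia.
Qed.

(** Reversal is a product of [m./2] transpositions; the induction instead peels off the first point,
    which goes to the last place. *)
Lemma odd_rev_perm m : odd_perm (perm (@rev_ord_inj m)) = odd m./2.
Proof.
elim: m => [|m IH].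
  have -> : perm (@rev_ord_inj 0) = 1 by apply/permP => -[].
  by rewrite odd_perm1.
have -> : perm (@rev_ord_inj m.+1) = lift_perm ord0 ord_max (perm (@rev_ord_inj m)).
  apply/permP => x; rewrite permE; apply/ord_inj.
  case: (unliftP ord0 x) => [u ->|->]; rewrite ?lift_perm_lift ?lift_perm_id /= ?permE /=.
    by rewrite /bump /=; have := ltn_ord u; lia.
  by rewrite subn1.
by rewrite odd_lift_perm IH /=; lia.
Qed.

Lemma signed_hmap n : 1 <= n -> signed (odd (n - 1)./2) (@hmap n).
Proof.
case: n => [|m] // _; exists (lift_perm ord_max ord_max (perm (@rev_ord_inj m))).
  by rewrite odd_lift_perm odd_rev_perm subn1 /=; case: odd.
move=> x y /hmapP h; apply/ord_inj.
case: (unliftP ord_max x) h => [u ->|->]; rewrite ?lift_perm_lift ?lift_perm_id ?permE /=.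
  by rewrite /bump /=; have := ltn_ord u; lia.
by lia.
Qed.

(** * Rotations of n - 1 points *)

Section CorankOne.

Variable n : nat.
Hypothesis n_ge3 : 3 <= n.
Implicit Types (a b c : pperm n) (x y z : 'I_n).

Local Notation E := (seg 1 (n - 1) : {set 'I_n}).

Lemma mem_E x : (x \in E) = (x.+1 < n).
Proof. by rewrite inE /label; have := ltn_ord x; lia. Qed.

Lemma Dom_gmap : Dom (@gmap n) = E.
Proof.
apply/setP => x; rewrite mem_E; apply/DomP/idP => [[y /gmapP]|lt]; first by lia.
have [lt'|ge] := ltnP x.+2 n.
  by exists (Ordinal lt); apply/gmapP; left.
have n0 : 0 < n by lia.
by exists (Ordinal n0); apply/gmapP; right; split=> //=; lia.
Qed.

Lemma Im_gmap : Im (@gmap n) = E.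
Proof.
apply/eqP; rewrite eqEcard -card_Dom Dom_gmap leqnn andbT.
by apply/subsetP => y /ImP[x /gmapP]; rewrite mem_E; lia.
Qed.

Lemma Im_hmap : Im (@hmap n) = E.
Proof.
apply/setP => y; rewrite mem_E; apply/ImP/idP => [[x /hmapP]|lt]; first by lia.
have lt' : n - y - 2 < n by lia.
by exists (Ordinal lt'); apply/hmapP => /=; lia.
Qed.

Lemma Dom_hmap : Dom (@hmap n) = E.
Proof. by rewrite -Im_pinv hmap_inv Im_hmap. Qed.

(** Powers of the rotation inside the group H-class of [pid E]; the zeroth power is therefore
    [pid E] and not 1. *)
Fixpoint gpow k : pperm n := if k is k'.+1 then gpow k' * gmap else pid E.

Lemma gpow_spec k : [/\ Dom (gpow k) = E, Im (gpow k) = E, cyclic_on (gpow k),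
  signed (odd k && odd n) (gpow k) &
  k.+1 < n -> forall x y, x = 0 :> nat -> y = k :> nat -> gpow k x = Some y].
Proof.
elim: k => [|k [D I c s IH]] /=.
  split; rewrite ?Dom_pid ?Im_pid //; [exact: cyclic_pid|exact: signed_pid|].
  by move=> _ x y x0 y0; apply/pidP; rewrite mem_E; split; [lia|apply/ord_inj; lia].
split.
- by rewrite Dom_mul ?I ?Dom_gmap.
- by rewrite Im_mul ?I ?Dom_gmap // Im_gmap.
- exact: cyclic_mul c (@gmap_cyclic n).
- have -> : ~~ odd k && odd n = (odd k && odd n) (+) odd n by case: odd; case: odd.
  by apply: signed_mul s (signed_gmap _); lia.
move=> lt x y x0 yk; have ltk : k < n by lia.
apply/pmulP; exists (Ordinal ltk); first by apply: IH => //; lia.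
by apply/gmapP; left => /=; lia.
Qed.

Lemma cyclic_increasing a x0 : x0 = 0 :> nat -> a x0 = Some x0 -> cyclic_on a ->
  increasing a.
Proof.
move=> e0 a0 c x y x' y' ax ay lt.
have inj u v u' v' : a u = Some u' -> a v = Some v' -> u != v -> u' != v'.
  by move=> au av; apply: contraNneq => e; apply/eqP/(pperm_inj au); rewrite e.
have [x00|nx0] := eqVneq x0 x.
  move: ax; rewrite -x00 a0 => -[<-].
  have ny : y' != x0 by apply: (inj _ _ _ _ ay a0); rewrite x00 neq_ltn lt orbT.
  by rewrite e0 lt0n -e0.
have nx' : x0 != x' :> nat := inj _ _ _ _ a0 ax nx0.
have nx : x0 != x :> nat := nx0.
have := c _ _ _ _ _ _ a0 ax ay; have : x0 <= x' by rewrite e0.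
by move: nx nx'; rewrite /cyc e0; lia.
Qed.

(** Rotate back by the image of 0. The result fixes 0 and preserves the cyclic order, so it is
    increasing, hence the identity of E. *)
Lemma cyclic_gpow b : Dom b = E -> Im b = E -> cyclic_on b -> exists k, b = gpow k.
Proof.
move=> D I c; have n0 : 0 < n by lia.
pose x0 := Ordinal n0.
have /DomP[j bj] : x0 \in Dom b by rewrite D mem_E /=; lia.
have jE : j.+1 < n by rewrite -mem_E -I (mem_Im bj).
have [Dg Ig cg _ g0] := gpow_spec j; exists j.
have h : b * (gpow j)^-1 = pid E.
  have eD : Dom (b * (gpow j)^-1) = E by rewrite Dom_mul ?I ?Dom_pinv ?Ig.
  rewrite -[in RHS]eD; apply: increasing_pid.
    by rewrite eD Im_mul ?Im_pinv ?Dom_pinv ?I ?Ig.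
  apply: (@cyclic_increasing _ x0) => //.
    by apply/pmulP; exists j => //; apply/pinvP/g0.
  exact: cyclic_mul c (cyclic_inv cg).
rewrite -[LHS](mul_pid_id (subxx (Im b))) I -Ig -pmulVl mulgA h.
by rewrite pid_mul_id ?Dg.
Qed.

Lemma seg_card : #|E| = n - 1.
Proof. by case: n n_ge3 => // m _; rewrite seg_n1 cardC1n. Qed.

(** For n even the rotation is a cycle of odd length n - 1, so all its powers are even and none can
    repair a wrong sign. *)
Lemma signed_cyclic b : ~~ odd n -> Dom b = E -> Im b = E -> cyclic_on b -> signed false b.
Proof.
move=> nn D I /(cyclic_gpow D I)[k ->].
by have [_ _ _ + _] := gpow_spec k; rewrite (negPf nn) andbF.
Qed.

End CorankOne.

(** * The monoids AOP and AOR *)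

Section AlternatingOriented.

Variable n : nat.
Implicit Types (a b c : pperm n) (x y z : 'I_n) (A B : {set 'I_n}).

Lemma AOP_P a : a \in AOP n <-> signed false a /\ cyclic_on a.
Proof.
rewrite inE -alternatingP -orientation_preservingP.
by split=> [/andP[]|[-> ->]].
Qed.

Lemma AOR_P a : a \in AOR n <-> signed false a /\ (cyclic_on a \/ anticyclic_on a).
Proof.
rewrite inE -alternatingP -orientation_preservingP -orientation_reversingP.
by split=> [/andP[-> /orP]|[-> /orP]].
Qed.

Lemma sub_AOP_AOR : AOP n \subset AOR n.
Proof. by apply/subsetP => a /AOP_P[s c]; apply/AOR_P; split=> //; left. Qed.

Lemma inverse_submonoid_AOP : inverse_submonoid (AOP n).
Proof.
split=> [a b /AOP_P[s c] /AOP_P[t d]|a /AOP_P[s c]|A]; apply/AOP_P; split.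
- exact: signed_mul s t.
- exact: cyclic_mul.
- exact: signed_inv.
- exact: cyclic_inv.
- exact: signed_pid.
- exact: cyclic_pid.
Qed.

Lemma inverse_submonoid_AOR : inverse_submonoid (AOR n).
Proof.
split=> [a b /AOR_P[s c] /AOR_P[t d]|a /AOR_P[s c]|A]; apply/AOR_P; split.
- exact: signed_mul s t.
- case: c d => [c|c] [d|d]; [left|right|right|left].
  + exact: cyclic_mul.
  + exact: cyclic_antimul.
  + exact: anticyclic_mul.
  + exact: anticyclic_antimul.
- exact: signed_inv.
- by case: c => c; [left; apply: cyclic_inv|right; apply: anticyclic_inv].
- exact: signed_pid.
- by left; apply: cyclic_pid.
Qed.

Hypothesis n_ge3 : 3 <= n.

Lemma card_seg1 k : k <= n -> #|@seg n 1 k| = k.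
Proof.
move=> le_k; have -> : seg 1 k = [set widen_ord le_k x | x in 'I_k] :> {set 'I_n}.
  apply/setP => x; rewrite inE /label; apply/idP/imsetP => [/andP[_ lt]|[y _ ->]] /=.
    by exists (Ordinal lt) => //; apply/ord_inj.
  exact: ltn_ord.
by rewrite card_imset ?card_ord // => x y /(congr1 val)/= /ord_inj.
Qed.

Lemma seg1_last : exists2 e : 'I_n, seg 1 (n - 1) = [set~ e] & odd e = odd (n - 1).
Proof.
by case: n n_ge3 => // m _; exists ord_max; [exact: seg_n1|rewrite subn1].
Qed.

Lemma seg2_first : exists2 e : 'I_n, seg 2 n = [set~ e] & odd e = false.
Proof. by case: n n_ge3 => // m _; exists ord0; [exact: seg_2n|]. Qed.

Lemma order_bij_small A B : #|A| = #|B| -> #|A| <= n - 2 -> order_bij A B \in AOP n.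
Proof.
move=> cAB le; apply/AOP_P; split; last exact: cyclic_order_bij.
by apply: signed_small; rewrite ?Dom_order_bij //; lia.
Qed.

Lemma order_bij_C1 (i j : 'I_n) : odd i = odd j -> order_bij [set~ i] [set~ j] \in AOP n.
Proof.
move=> e; apply/AOP_P; split; last by apply: cyclic_order_bij; rewrite !cardC1n.
by have := signed_order_bij_C1 i j; rewrite e addbb.
Qed.

(* Conjugating by order bijections makes [Dom a] and [Im a] equal to [seg 1    *)
(* (n - 1)] at the cost of a sign [odd d (+) odd i]; the resulting rotation (or *)
(* reflection, when n = 2 mod 4) of n - 1 points is even.                      *)
Lemma corank1_parity a : ~~ odd n -> #|Dom a| = n - 1 -> signed false a ->
  cyclic_on a \/ anticyclic_on a /\ n = 2 %[mod 4] ->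
  odd (missing (Dom a)) = odd (missing (Im a)).
Proof.
move=> nn cD s ca; have cI : #|Im a| = n - 1 by rewrite -card_Dom.
have n0 : 0 < n by lia.
have [d eD] := card_n1P n0 cD; have [i eI] := card_n1P n0 cI.
have [e eE _] := seg1_last.
pose b := order_bij (seg 1 (n - 1)) (Dom a) * a * order_bij (Im a) (seg 1 (n - 1)).
have cE := seg_card n_ge3.
have sb : signed ((odd e (+) odd d) (+) false (+) (odd i (+) odd e)) b.
  by rewrite /b eE eD eI; do 2?apply: signed_mul => //; apply: signed_order_bij_C1.
have c1 : cyclic_on (order_bij (seg 1 (n - 1)) (Dom a)).
  by apply: cyclic_order_bij; rewrite cE.
have c2 : cyclic_on (order_bij (Im a) (seg 1 (n - 1))).
  by apply: cyclic_order_bij; rewrite cE.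
have Im1 : Im (order_bij (seg 1 (n - 1)) (Dom a) * a) = Im a.
  by rewrite Im_mul ?Im_order_bij ?cE.
have bD : Dom b = seg 1 (n - 1).
  by rewrite /b Dom_mul ?Im1 ?Dom_order_bij ?cE // Dom_mul ?Dom_order_bij ?Im_order_bij ?cE.
have bI : Im b = seg 1 (n - 1).
  by rewrite /b Im_mul ?Im_order_bij ?Dom_order_bij ?Im1 ?cE.
have sb' : signed false b.
  case: ca => [ca|[ca n4]].
    by apply: signed_cyclic => //; do 2?apply: cyclic_mul.
  (* Composing with the reversal reduces to the cyclic case; the reversal itself is even since n = 2
     mod 4. *)
  have cb : anticyclic_on b by apply: anticyclic_mul c2; apply: cyclic_antimul ca.
  have sbh : signed false (b * hmap).
    apply: signed_cyclic => //.
    - by rewrite Dom_mul ?bI ?Dom_hmap.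
    - by rewrite Im_mul ?bI ?Im_hmap ?Dom_hmap.
    exact: anticyclic_antimul cb (@hmap_anticyclic n).
  have sh : signed false (@hmap n).
    have -> : false = odd (n - 1)./2 by lia.
    by apply: signed_hmap; lia.
  have := signed_mul sbh (signed_inv sh).
  by rewrite -mulgA pmulV Dom_hmap // mul_pid_id // bI.
have := signed_uniq _ sb sb'; rewrite bD cE leqnn => /(_ isT).
by rewrite eD eI !missingC1 /=; case: (odd e) (odd d) (odd i) => [] [] [].
Qed.

Variable M : {set pperm n}.
Hypothesis sAOP : AOP n \subset M.

Lemma frame_rank k : 1 <= k <= n - 2 \/ k = n ->
  frame M (@has_card n k) (seg 1 k) (tilde k).
Proof.
move=> hk; have le_k : k <= n by lia.
have [ek|nk] := eqVneq k n.
  have segT : seg 1 k = setT :> {set 'I_n}.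
    by apply/eqP; rewrite eqEcard subsetT card_seg1 // cardsT card_ord ek leqnn.
  exists (fun=> pid setT); split.
  - by rewrite /has_card card_seg1 ?eqxx.
  - move=> A /eqP cA; rewrite segT Dom_pid Im_pid; split=> //.
      by apply: (subsetP sAOP); case: inverse_submonoid_AOP.
    by apply/esym/eqP; rewrite eqEcard subsetT cardsT card_ord cA ek leqnn.
  - by move=> a _; rewrite /has_card card_Dom.
  by move=> a _ _; rewrite /tilde ek eqxx pid_inv mul_pid_id // pid_mul_id.
have lk : k <= n - 2 by lia.
exists (order_bij (seg 1 k)); split.
- by rewrite /has_card card_seg1 ?eqxx.
- move=> A /eqP cA; rewrite Dom_order_bij ?Im_order_bij ?card_seg1 //; split=> //.
  by apply: (subsetP sAOP); apply: order_bij_small; rewrite card_seg1.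
- by move=> a _; rewrite /has_card card_Dom.
move=> a _ /eqP cD.
by rewrite /tilde (negPf nk) lk /tilde_rank order_bij_inv // card_seg1 // -card_Dom.
Qed.

(** Order bijections between complements of points of equal parity are even. The base sets miss the
    labels 1 and n, which are odd and even respectively. *)
Lemma frame_corank1 p : ~~ odd n ->
  (forall a, a \in M -> #|Dom a| = n - 1 ->
     odd (missing (Dom a)) = odd (missing (Im a))) ->
  frame M (@corank1 n p) (if p then seg 2 n else seg 1 (n - 1))
    (if p then @tilde_odd n else @tilde_even n).
Proof.
move=> nn par; have n0 : 0 < n by lia.
pose F : {set 'I_n} := if p then seg 2 n else seg 1 (n - 1).
have [e eF oe] : exists2 e : 'I_n, F = [set~ e] & odd (label e) = p.
  rewrite /F; case: (p).
    by have [e -> oe] := seg2_first; exists e; rewrite //= oe.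
  by have [e -> oe] := seg1_last; exists e; rewrite //= oe; lia.
have cF : #|F| = n - 1 by rewrite eF cardC1n.
exists (order_bij F); split.
- by rewrite -/F eF /corank1 cardC1n missingC1 oe !eqxx.
- move=> A /andP[/eqP cA /eqP mA].
  rewrite Dom_order_bij ?Im_order_bij ?cF //; split=> //.
  have [d ed] := card_n1P n0 cA; rewrite ed missingC1 /= in mA *.
  by apply: (subsetP sAOP); rewrite eF order_bij_C1 //; move: oe; rewrite -mA /=; lia.
- move=> a Ma; rewrite /corank1 card_Dom.
  by case: eqP => //= ca; rewrite par // card_Dom.
move=> a _ /andP[/eqP cD _]; rewrite (order_bij_inv (A := F)) ?cF -?card_Dom //.
by rewrite /F; case: (p).
Qed.

(** Common shape of the two cases with a single class of rank n - 1: q selects the sets A whose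
    order bijection from [seg 1 (n - 1)] is left untouched, and for the others w is meant to repair
    the sign. The right factor is the inverse of the left one, as a frame requires. *)
Lemma frame_twisted (w : pperm n) (q : {set 'I_n} -> bool) tl :
  Dom w = seg 1 (n - 1) -> Im w = seg 1 (n - 1) ->
  (forall A, #|A| = n - 1 ->
     (if q A then order_bij (seg 1 (n - 1)) A
      else w^-1 * order_bij (seg 1 (n - 1)) A) \in M) ->
  (forall a, #|Dom a| = n - 1 -> tl a =
    (if q (Dom a) then order_bij (seg 1 (n - 1)) (Dom a)
     else w^-1 * order_bij (seg 1 (n - 1)) (Dom a)) * a
    * (if q (Im a) then order_bij (Im a) (seg 1 (n - 1))
       else order_bij (Im a) (seg 1 (n - 1)) * w)) ->
  frame M (@has_card n (n - 1)) (seg 1 (n - 1)) tl.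
Proof.
move=> Dw Iw lamM tlE; have cE := seg_card n_ge3.
exists (fun A => if q A then order_bij (seg 1 (n - 1)) A
                 else w^-1 * order_bij (seg 1 (n - 1)) A); split.
- by rewrite /has_card cE ?eqxx.
- move=> A /eqP cA; split; first exact: lamM.
    case: ifP => _; first by rewrite Dom_order_bij ?cE.
    by rewrite Dom_mul ?Im_pinv ?Dom_pinv ?Dw ?Dom_order_bij ?cE.
  case: ifP => _; first by rewrite Im_order_bij ?cE.
  by rewrite Im_mul ?Im_pinv ?Dw ?Im_order_bij ?Dom_order_bij ?cE.
- by move=> a _; rewrite /has_card card_Dom.
move=> a _ /eqP cD; rewrite tlE //; congr (_ * _).
case: ifP => _; rewrite ?invMg order_bij_inv ?invgK // cE -card_Dom //.
Qed.

Lemma frame_odd : odd n -> frame M (@has_card n (n - 1)) (seg 1 (n - 1)) (tilde (n - 1)).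
Proof.
move=> on; apply: (@frame_twisted gmap (fun A => odd (missing A))).
- exact: Dom_gmap.
- exact: Im_gmap.
- move=> A cA; have [|d ed] := card_n1P _ cA; first by lia.
  have [e eE oe] := seg1_last; rewrite ed missingC1 eE /=.
  have oe0 : odd e = false by rewrite oe; lia.
  apply: (subsetP sAOP); case: ifP => od.
    by apply: order_bij_C1; rewrite oe0; move: od; case: odd.
  apply/AOP_P; split.
    have -> : false = odd n (+) (odd e (+) odd d) by rewrite oe0 on; move: od; case: odd.
    apply: signed_mul (signed_order_bij_C1 e d).
    by apply/signed_inv/signed_gmap; lia.
  apply: cyclic_mul (cyclic_inv (@gmap_cyclic n)) _.
  by apply: cyclic_order_bij; rewrite !cardC1n.
move=> a _; rewrite /tilde /tilde_n_odd on.
have -> : (n - 1 == n) = false by lia.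
by have -> : (n - 1 <= n - 2) = false by lia.
Qed.

End AlternatingOriented.

Lemma frame_mod4 n : 3 <= n -> n = 0 %[mod 4] ->
  frame (AOR n) (@has_card n (n - 1)) (seg 1 (n - 1)) (tilde (n - 1)).
Proof.
move=> n3 n4; have nn : odd n = false by lia.
apply: (@frame_twisted n n3 _ hmap (fun A => ~~ odd (missing A))).
- exact: Dom_hmap.
- exact: Im_hmap.
- move=> A cA; have [|d ed] := card_n1P _ cA; first by lia.
  have [e eE oe] := seg1_last n3; rewrite ed missingC1 eE /= negbK.
  have oe1 : odd e = true by rewrite oe; lia.
  case: ifP => od.
    by apply: (subsetP (sub_AOP_AOR n)); apply: order_bij_C1; rewrite oe1 od.
  apply/AOR_P; split.
    have -> : false = odd (n - 1)./2 (+) (odd e (+) odd d).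
      have -> : odd (n - 1)./2 = true by lia.
      by rewrite oe1 od.
    apply: signed_mul (signed_order_bij_C1 e d).
    by apply/signed_inv/signed_hmap; lia.
  right; apply: anticyclic_mul (anticyclic_inv (@hmap_anticyclic n)) _.
  by apply: cyclic_order_bij; rewrite !cardC1n.
move=> a _; rewrite /tilde /tilde_n_mod4 nn hmap_inv.
have -> : (n - 1 == n) = false by lia.
by have -> : (n - 1 <= n - 2) = false by lia.
Qed.

(** As n is even, a point of the other parity has both its cyclic neighbours of parity p, hence
    fixed. Its image lies strictly between them in the cyclic order, where it is the only point. *)
Lemma cyclic_rigid n (p : bool) (h : pperm n) : 4 <= n -> ~~ odd n ->
  Dom h = setT -> cyclic_on h ->
  (forall x, odd (label x) = p -> h x = Some x) -> h = 1.
Proof.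
move=> n4 nn DT c fixp; apply: ppermP => x; rewrite ffunE inE.
have [px|npx] := eqVneq (odd (label x)) p; first exact: fixp.
(* The points u and v are the cyclic predecessor and successor of x, with wrap-around at 0 and n -
   1. *)
have lt_u : (if x == 0 :> nat then n - 1 else x - 1) < n.
  by have := ltn_ord x; case: ifP; lia.
have lt_v : (if x.+1 == n then 0 else x.+1) < n.
  by have := ltn_ord x; case: ifP; lia.
pose u := Ordinal lt_u; pose v := Ordinal lt_v.
have hu : h u = Some u.
  apply: fixp; move: npx; rewrite /label /=; have := ltn_ord x.
  by case: ifP; case: (p); lia.
have hv : h v = Some v.
  apply: fixp; move: npx; rewrite /label /=; have := ltn_ord x.
  by case: ifP; case: (p); lia.
have /DomP[y hx] : x \in Dom h by rewrite DT inE.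
rewrite hx; congr Some; apply/ord_inj.
have := c _ _ _ _ _ _ hu hx hv; rewrite /cyc /u /v /=.
by have := ltn_ord x; have := ltn_ord y; case: ifP; case: ifP; lia.
Qed.

(** From n = 6 on there are three points of parity p; being fixed, they keep a cyclic order that h
    would have to reverse. *)
Lemma anticyclic_not_fix n (p : bool) (h : pperm n) : 6 <= n ->
  anticyclic_on h -> (forall x, odd (label x) = p -> h x = Some x) -> False.
Proof.
move=> n6 c fixp.
have l0 : ~~ p + 0 < n by case: (p) => /=; lia.
have l2 : ~~ p + 2 < n by case: (p) => /=; lia.
have l4 : ~~ p + 4 < n by case: (p) => /=; lia.
have f (x : 'I_n) : odd x = ~~ p -> h x = Some x.
  by move=> ox; apply: fixp; rewrite /= ox negbK.
have := c (Ordinal l0) (Ordinal l2) (Ordinal l4) _ _ _ (f _ _) (f _ _) (f _ _).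
by rewrite /cyc /= ; case: (p) => /= /(_ erefl erefl erefl isT).
Qed.

(** Apply the two preceding facts to a b^-1, which fixes every point of parity p. In the anticyclic
    case n = 2 mod 4 together with n at least 4 gives n at least 6. *)
Lemma AOR_rigid n (p : bool) (a b : pperm n) : 4 <= n -> ~~ odd n ->
  (cyclic_on a \/ anticyclic_on a /\ n = 2 %[mod 4]) ->
  (cyclic_on b \/ anticyclic_on b /\ n = 2 %[mod 4]) ->
  Dom a = setT -> Dom b = setT ->
  (forall x, odd (label x) = p -> a x = b x) -> a = b.
Proof.
move=> n4 nn oa ob Da Db ab.
have Ia : Im a = setT by apply/eqP; rewrite eqEcard subsetT -card_Dom Da leqnn.
have Ib : Im b = setT by apply/eqP; rewrite eqEcard subsetT -card_Dom Db leqnn.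
have Dh : Dom (a * b^-1) = setT by rewrite Dom_mul ?Dom_pinv ?Ib ?Ia.
have fh x : odd (label x) = p -> (a * b^-1) x = Some x.
  move=> px; have /DomP[y ax] : x \in Dom a by rewrite Da inE.
  by apply/pmulP; exists y => //; apply/pinvP; rewrite -ab.
have oh : cyclic_on (a * b^-1) \/ anticyclic_on (a * b^-1) /\ n = 2 %[mod 4].
  case: oa ob => [ca|[ca m4]] [cb|[cb m4']].
  - by left; apply: cyclic_mul ca (cyclic_inv cb).
  - by right; split=> //; apply: cyclic_antimul ca (anticyclic_inv cb).
  - by right; split=> //; apply: anticyclic_mul ca (cyclic_inv cb).
  - by left; apply: anticyclic_antimul ca (anticyclic_inv cb).
have h1 : a * b^-1 = 1.
  case: oh => [ch|[ch m4]]; first exact: cyclic_rigid fh.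
  by case: (anticyclic_not_fix _ ch fh); lia.
by rewrite -[LHS](mul_pid_id (subxx (Im a))) Ia -Ib -pmulVl mulgA h1 mul1g.
Qed.

Theorem theorem3p6 (n : nat) (n_ge3 : 3 <= n) (M : {set pperm n})
    (defM : M = AOP n \/ M = AOR n) :
  (M = AOP n /\ odd n \/ M = AOR n /\ n <> 2 %[mod 4] ->
   forall R : {set pperm n * pperm n},
     congruence M R <->
     R = setX M M \/
     exists (k : nat) (rho : {set pperm n * pperm n}),
       [/\ 1 <= k <= n,
           congruence (Hclass M (pid (seg 1 k))) rho
         & R = piJ M (rankJ M k) (tilde k) rho])
  /\
  (M = AOP n /\ ~~ odd n \/ M = AOR n /\ n = 2 %[mod 4] ->
   forall R : {set pperm n * pperm n},
     congruence M R <->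
     [\/ R = setX M M,
         exists (k : nat) (rho : {set pperm n * pperm n}),
           [/\ 1 <= k <= n - 2 \/ k = n,
               congruence (Hclass M (pid (seg 1 k))) rho
             & R = piJ M (rankJ M k) (tilde k) rho]
       | exists rho1 rho2 : {set pperm n * pperm n},
           [/\ congruence (Hclass M (pid (seg 2 n))) rho1,
               congruence (Hclass M (pid (seg 1 (n - 1)))) rho2
             & [\/ R = piJ M (oddJ M) (@tilde_odd n) rho1,
                   R = piJ M (evenJ M) (@tilde_even n) rho2
                 | R = thetaJ M (oddJ M) (@tilde_odd n) rho1
                       :|: thetaJ M (evenJ M) (@tilde_even n) rho2]]]).
Proof.
have invM : inverse_submonoid M.
  by case: defM => ->; [apply: inverse_submonoid_AOP|apply: inverse_submonoid_AOR].
have sM : AOP n \subset M by case: defM => ->; rewrite ?sub_AOP_AOR.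
split=> hM R.
  apply: congruences_one_class => // k /andP[k1 kn].
  have [hk|nhk] := boolP ((k <= n - 2) || (k == n)).
    by apply: frame_rank => //; move: hk; lia.
  (* Only rank n - 1 distinguishes the cases: the rotation supplies the frame for n odd, the
     reversal for [AOR n] with n = 0 mod 4. *)
  have -> : k = n - 1 by move: nhk; lia.
  case on: (odd n); first exact: frame_odd.
  case: hM => [[_]|[-> n4]]; first by rewrite on.
  by apply: frame_mod4 => //; lia.
have nn : ~~ odd n by case: hM => [[]|[_ n4]] //; lia.
have orM a : a \in M -> signed false a /\
    (cyclic_on a \/ anticyclic_on a /\ n = 2 %[mod 4]).
  case: hM => [[-> _] /AOP_P[sa ca]|[-> n4] /AOR_P[sa [ca|ca]]]; split=> //.
  - by left.
  - by left.
  - by right.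
have n_ge4 : 4 <= n by lia.
apply: (@congruences_two_classes n M n_ge4 invM
  (fun p => if p then seg 2 n else seg 1 (n - 1))
  (fun p => if p then @tilde_odd n else @tilde_even n)) => [k|p|p a b Ma Mb].
- exact: frame_rank.
- apply: frame_corank1 => // a /orM[sa oa] cD; exact: corank1_parity.
by move/orM: Ma => [_ oa]; move/orM: Mb => [_ ob]; apply: AOR_rigid.
Qed.
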